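(* For every $\varepsilon>0$, there is a deterministic algorithm in the $\mathsf{LOCAL}$ model that, on every finite simple planar graph $G$, computes an $(8+\varepsilon)$-approximation of minimum dominating set, i.e. a dominating set of $G$ of size at most $(8+\varepsilon)$ times the minimum size of a dominating set of $G$, in a constant number of communication rounds (a number of rounds bounded by a constant that depends only on $\varepsilon$, and not on $G$).
   Context: A dominating set of a graph $G=(V,E)$ is a set $D\subseteq V$ such that every vertex is in $D$ or has a neighbor in $D$. $\mathsf{LOCAL}$ model: the input graph is the communication network; the vertices have pairwise distinct identifiers, and initially each vertex knows its own identifier. Computation proceeds in synchronous rounds; in each round every vertex may send a message to each of its neighbors, receive messages from its neighbors, and perform arbitrary local computation. There is no limit on message size or local computation. At the end each vertex decides whether it belongs to the output set. Neither a planar embedding nor the number of vertices of $G$ is part of the input. *)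

(* Defs.v *)
From HB Require Import structures.
From mathcomp Require Import all_boot all_order all_algebra.
From mathcomp Require Import all_classical all_reals all_analysis.
Import Order.TTheory GRing.Theory Num.Theory.
Import numFieldNormedType.Exports.

Set Implicit Arguments.
Unset Strict Implicit.
Unset Printing Implicit Defensive.

Local Open Scope classical_set_scope.
Local Open Scope ring_scope.

(** A finite simple graph is a symmetric irreflexive [E : rel V] on a
    [V : finType]. *)

Section Domination.
Variables (V : finType) (E : rel V).

Definition dominating (D : {set V}) : bool :=
  [forall v, (v \in D) || [exists u in D, E v u]].

(** The default [[set: V]] is always dominating, so this is a true minimum. *)
Definition domination_number : nat :=
  #|[arg min_(D < [set: V]%SET | dominating D) #|D| ]%N|.

End Domination.

(** A plane drawing: vertices are distinct points, every edge is a simple arc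
    between its ends, and the interior of an arc contains no vertex and no point
    of another edge.  Each edge [{u, v}] is listed once per orientation, as
    [arc u v] and [arc v u], which are the same curve run in opposite
    directions.  Values of [arc u v] with [~~ E u v] are irrelevant. *)
Record plane_drawing (R : realType) (V : finType) (E : rel V)
    (pos : V -> R * R) (arc : V -> V -> R -> R * R) : Prop := PlaneDrawing {
  pos_inj : injective pos;
  arc_continuous : forall u v, E u v ->
    {within `[0, 1]%classic, continuous (arc u v)};
  arc_inj : forall u v, E u v -> {in `[0, 1] &, injective (arc u v)};
  arc_start : forall u v, E u v -> arc u v 0 = pos u;
  arc_end : forall u v, E u v -> arc u v 1 = pos v;
  arc_reverse : forall u v, E u v -> {in `[0, 1], forall t,
    arc v u t = arc u v (1 - t)};
  arc_avoids_vertices : forall u v w, E u v ->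
    {in `]0, 1[, forall t, arc u v t <> pos w};
  arc_avoids_arcs : forall u v x y, E u v -> E x y ->
    [set u; v]%SET <> [set x; y]%SET ->
    {in `]0, 1[ &, forall s t, arc u v s <> arc x y t}
}.

Definition planar (R : realType) (V : finType) (E : rel V) : Prop :=
  exists pos arc, @plane_drawing R V E pos arc.

(** A deterministic LOCAL algorithm; every vertex runs the same one.  [init]
    receives the identifier of the vertex and nothing else.  A vertex refers to
    its neighbors through local ports: [send s i] is the message for the
    neighbor on port [i] ([None]: no message), and the [i]-th item of the list
    given to [receive] is what arrived on port [i].  No restriction is put on
    the types and functions: message size and local computation are unbounded. *)
Record local_algorithm := LocalAlgorithm {
  state : Type;
  message : Type;
  init : nat -> state;
  send : state -> nat -> option message;
  receive : state -> seq (option message) -> state;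
  decide : state -> bool
}.

(** [port v] lists the neighbors of [v], the one on port [i] at index [i]. *)
Definition port_numbering (V : finType) (E : rel V) (port : V -> seq V) : Prop :=
  forall v, uniq (port v) /\ port v =i E v.

Section Execution.
Variables (A : local_algorithm) (V : finType).
Variables (port : V -> seq V) (ident : V -> nat).

Definition inbox (st : V -> state A) (v : V) : seq (option (message A)) :=
  [seq send (st u) (index v (port u)) | u <- port v].

Definition round (st : V -> state A) : V -> state A :=
  fun v => receive (st v) (inbox st v).

Definition run (T : nat) : V -> state A :=
  iter T round (fun v => init A (ident v)).

Definition local_output (T : nat) : {set V} := [set v | decide (run T v)]%SET.

End Execution.

(* Main.v *)
Require Import Defs.
From HB Require Import structures.
From mathcomp Require Import all_boot all_order all_algebra.
From mathcomp Require Import all_classical all_reals all_analysis.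
From mathcomp Require Import ring lra zify.
Import Order.TTheory GRing.Theory Num.Theory.
Import numFieldNormedType.Exports.

Set Implicit Arguments.
Unset Strict Implicit.
Unset Printing Implicit Defensive.

Local Open Scope ring_scope.

(** A dominating set [D] of a planar graph meets almost all vertices whose
    neighborhood cannot be dominated by [k] other vertices, and almost all pairs
    of vertices with [3k + 1] common neighbors that such "hard" vertices leave
    undominated: contracting the stars of [D] gives a planar minor in which every
    exception has degree greater than [k], and as minors of planar graphs are
    sparse there are [O(#|D| / k)] exceptions.  A vertex that is not hard lies in at most [k] such
    pairs, so the pairs form a graph of bounded degree, for which a primal-dual
    vertex cover is computed in a constant number of rounds; after selecting it,
    every closed neighborhood contains a bounded number of undominated vertices.
    These are handled by a primal-dual algorithm that loses a factor close to
    7 = 2 * 3 + 1, as planar graphs have at most 3n edges.  A vertex of [D] left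
    out by the first two steps pays at most once for the vertex cover and 7 times
    for the last step; the other ones pay less than 8.

    The two consequences of planarity (no [K_{3,3}] subgraph, at most [3n] edges
    in a minor) come from a mod 2 winding number argument in the style of van
    Kampen and Flores, showing that in a plane drawing of [K_5] or [K_{3,3}] by
    arbitrary curves some two disjoint edges meet, and from Mader's argument for
    the number of edges of a graph without [K_5] minor. *)

(** * Mod 2 winding of chains of points *)

Section Parity.
Variables (R : realFieldType) (d : R).
Implicit Types (a b w : R * R) (s t : seq (R * R)).

(* [upper] selects one vector of each pair of opposite nonzero vectors; a short
   step from [w] to [w'] away from the origin crosses the positive x-axis iff
   [cross w w']. *)
Definition upper w := (0 < w.2) || ((w.2 == 0) && (0 < w.1)).

Definition cross w w' := (0 < w.1) && (upper w (+) upper w').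

(** Both relations refer to the sup norm. When two points that are [apart] each move to a [nearby]
    point, their difference changes by at most [2 * d] and misses the origin. *)
Definition nearby a b := (`|a.1 - b.1| <= d) && (`|a.2 - b.2| <= d).

Definition apart a b := (2 * d < `|a.1 - b.1|) || (2 * d < `|a.2 - b.2|).

Lemma upper_opp a b : a != b -> upper (b - a) = ~~ upper (a - b).
Proof.
case: a b => [x y] [x' y']; rewrite /upper xpair_eqE /=.
rewrite !subr_gt0 !subr_eq0 negb_and.
by case: (ltgtP x x') => hx; case: (ltgtP y y') => hy.
Qed.

Lemma apart_neq a b : 0 <= d -> apart a b -> a != b.
Proof.
move=> d0; apply: contraTneq => ->; rewrite /apart !subrr normr0.
by rewrite orbb -leNgt mulr_ge0.
Qed.

Lemma upper_ge0 w : upper w -> 0 <= w.2.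
Proof. by case/orP=> [/ltW //|/andP[/eqP->]]. Qed.

Lemma upperN_le0 w : ~~ upper w -> w.2 <= 0.
Proof. by rewrite negb_or -leNgt => /andP[]. Qed.

(* If two of the vectors lie on different sides of the x-axis, then all of them
   are near that axis, hence away from the y-axis and on the same side of it. *)
Lemma same_side (x y : bool -> bool -> R) :
  (forall i j i' j', `|x i j - x i' j'| <= 2 * d) ->
  (forall i j i' j', `|y i j - y i' j'| <= 2 * d) ->
  (forall i j, (2 * d < `|x i j|) || (2 * d < `|y i j|)) ->
  (forall i j i' j', upper (x i j, y i j) = upper (x i' j', y i' j')) \/
  ((forall i j, 0 < x i j) \/ (forall i j, x i j < 0)).
Proof.
move=> hx hy hf.
have [|/forallPn[[[[i j] i'] j'] /= ne]] := boolP [forall k : bool * bool * bool * bool,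
   upper (x k.1.1.1 k.1.1.2, y k.1.1.1 k.1.1.2) ==
   upper (x k.1.2 k.2, y k.1.2 k.2)].
  by move=> /forallP h; left=> i j i' j'; apply/eqP/(h (i, j, i', j')).
right; wlog [u l] : i j i' j' ne / upper (x i j, y i j) /\ ~~ upper (x i' j', y i' j').
  move=> H; case u: (upper (x i j, y i j)) ne => ne.
    by apply: (H i j i' j'); rewrite ?u //; case: upper ne.
  by apply: (H i' j' i j); rewrite ?u //; case: upper ne.
have /= u0 := upper_ge0 u; have /= l0 := upperN_le0 l.
have big k m : 2 * d < `|x k m|.
  have /orP[//|] := hf k m; rewrite ltNge => /negP[].
  by move: (hy k m i j) (hy k m i' j'); rewrite !ler_norml => /andP[? ?] /andP[? ?]; lra.
have same k m : (0 < x i j) = (0 < x k m).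
  by move: (big i j) (big k m) (hx i j k m); rewrite ler_norml => + + /andP[? ?];
    case: (ltrgt0P (x i j)) => ? ?; case: (ltrgt0P (x k m)) => ? ? //; lra.
have [pos|neg] := boolP (0 < x i j); [left|right] => k m; first by rewrite -same.
move: neg (big k m); rewrite (same k m) -leNgt le_eqVlt => /predU1P[->|//].
by rewrite normr0; move: (hx k m k m); rewrite subrr normr0; lra.
Qed.

(** By [same_side], either [upper] is constant on the four differences and everything cancels, or
    their first coordinates have the same sign; then one pair of [cross] terms vanishes and the
    other pair gives the right-hand side. *)
Lemma cross_square a a' b b' : nearby a a' -> nearby b b' ->
  apart a b -> apart a' b -> apart a b' -> apart a' b' ->
  cross (b - a) (b' - a) (+) cross (b - a') (b' - a') (+)
  (cross (a - b) (a' - b) (+) cross (a - b') (a' - b')) =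
  upper (a - b) (+) upper (a' - b) (+) (upper (a - b') (+) upper (a' - b')).
Proof.
have [d0|dlt0] := leP 0 d; last first.
  by rewrite /nearby => /andP[/(le_trans (normr_ge0 _))]; rewrite leNgt dlt0.
move=> ca cb f1 f2 f3 f4.
rewrite /cross (upper_opp (apart_neq d0 f1)) (upper_opp (apart_neq d0 f2)).
rewrite (upper_opp (apart_neq d0 f3)) (upper_opp (apart_neq d0 f4)).
pose p (i : bool) := if i then a else a'; pose q (i : bool) := if i then b else b'.
have [| | |h|h] := @same_side (fun i j => (p i).1 - (q j).1) (fun i j => (p i).2 - (q j).2).
- move: ca cb => /andP[ca _] /andP[cb _]; move: ca cb; rewrite !ler_norml.
  move=> /andP[? ?] /andP[? ?] i j i' j'; rewrite ler_norml /p /q.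
  by case: i; case: j; case: i'; case: j'; lra.
- move: ca cb => /andP[_ ca] /andP[_ cb]; move: ca cb; rewrite !ler_norml.
  move=> /andP[? ?] /andP[? ?] i j i' j'; rewrite ler_norml /p /q.
  by case: i; case: j; case: i'; case: j'; lra.
- by case; case.
- move: (h true true false true) (h true true true false) (h true true false false).
  rewrite /upper /= => <- <- <-; rewrite !addbb.
  by case: (_ < _); case: (_ < _); case: (_ < _); case: (_ < _).
- have {h} h : (forall i j, (0 < (p i).1 - (q j).1) /\ (0 < (q j).1 - (p i).1) = false)
      \/ (forall i j, (0 < (p i).1 - (q j).1) = false /\ 0 < (q j).1 - (p i).1).
    by case: h => h; [left|right] => i j; move: (h i j) => hij; split; lra.
  case: h => h; have [/= r1 r2] := h true true; have [/= r3 r4] := h true false;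
    have [/= r5 r6] := h false true; have [/= r7 r8] := h false false;
    rewrite ?(r1, r2, r3, r4, r5, r6, r7, r8) /=;
    by case: (upper _); case: (upper _); case: (upper _); case: (upper _).
Qed.

(* The parity of the number of crossings of the positive x-axis by the chain
   [b :: t] seen from [a]. *)
Fixpoint turns a b t :=
  if t is b' :: t' then cross (b - a) (b' - a) (+) turns a b' t' else false.

(** Pasting of two identities along a common side, whose terms cancel mod 2: here the first chain is
    prolonged, in [addb_glue_right] the second. *)
Lemma addb_glue_left (p p' q r r' s' t' u u' v x x' y : bool) :
  p (+) p' (+) (r (+) r') = u (+) u' (+) (x (+) x') ->
  p' (+) q (+) (s' (+) t') = u' (+) v (+) (x' (+) y) ->
  p (+) q (+) ((r (+) s') (+) (r' (+) t')) = u (+) v (+) (x (+) y).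
Proof.
move=> e1 e2; have h z : z (+) z = false by case: z.
have -> : p (+) q (+) ((r (+) s') (+) (r' (+) t')) =
   (p (+) p' (+) (r (+) r')) (+) (p' (+) q (+) (s' (+) t')) (+) (p' (+) p').
  by rewrite h; clear e1 e2; move: p p' q r r' s' t' => [] [] [] [] [] [] [].
by rewrite e1 e2; clear e1 e2; move: u u' v x x' y p' => [] [] [] [] [] [] [].
Qed.

Lemma addb_glue_right (p p' q q' r s s' u u' v v' x x' : bool) :
  p (+) p' (+) (r (+) s) = u (+) u' (+) (x (+) x') ->
  q (+) q' (+) (s (+) s') = x (+) x' (+) (v (+) v') ->
  (p (+) q) (+) (p' (+) q') (+) (r (+) s') = u (+) u' (+) (v (+) v').
Proof.
move=> e1 e2; have h z : z (+) z = false by case: z.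
have -> : (p (+) q) (+) (p' (+) q') (+) (r (+) s') =
   (p (+) p' (+) (r (+) s)) (+) (q (+) q' (+) (s (+) s')) (+) (s (+) s).
  by rewrite h; clear e1 e2; move: p p' q q' r s s' => [] [] [] [] [] [] [].
by rewrite e1 e2; clear e1 e2; move: u u' v v' x x' s => [] [] [] [] [] [] [].
Qed.

(* The mod 2 form of the fact that [last b t - last a s] has the same argument
   whether one moves along the first chain or along the second chain first. *)
Lemma turns_grid a s b t : path nearby a s -> path nearby b t ->
    allrel apart (a :: s) (b :: t) ->
  turns a b t (+) turns (last a s) b t (+) (turns b a s (+) turns (last b t) a s) =
  upper (a - b) (+) upper (last a s - b) (+)
  (upper (a - last b t) (+) upper (last a s - last b t)).
Proof.
elim: s a => [|a' s IHs] a /=; first by rewrite !addbb.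
case/andP=> ca cs ct; rewrite allrel_consl => /andP[fa fs].
have {IHs} := IHs a' cs ct fs; apply: addb_glue_left.
move: fs ct fa; rewrite allrel_consl => /andP[fa' _].
elim: t b fa' => [|b' t IHt] b /=; first by rewrite !addbb.
case/andP=> fa'b fa'b' /andP[cb ct] /andP[fab fab'].
have := IHt b' fa'b' ct fab'.
have /andP[fa'b1 _] := fa'b'; have /andP[fab1 _] := fab'.
have := cross_square ca cb fab fa'b fab1 fa'b1.
exact: addb_glue_right.
Qed.
End Parity.

(** * Parity obstruction for K_5 and K_{3,3} *)

Section Obstruction.
Variables (R : realFieldType) (d : R).
Variables (p : nat -> R * R) (c : nat -> nat -> seq (R * R)).

(** Sums are taken in [bool] as the field with two elements, over pairs of edges that stay apart. *)
Lemma sum_turns_grid (es : seq (nat * nat)) (fs : seq ((nat * nat) * (nat * nat))) :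
    (forall e, e \in es -> path (nearby d) (p e.1) (c e.1 e.2) /\
                           last (p e.1) (c e.1 e.2) = p e.2) ->
    (forall f, f \in fs -> [/\ f.1 \in es, f.2 \in es &
       allrel (apart d) (p f.1.1 :: c f.1.1 f.1.2) (p f.2.1 :: c f.2.1 f.2.2)]) ->
  \sum_(f <- fs)
    (turns (p f.1.1) (p f.2.1) (c f.2.1 f.2.2) +
     turns (p f.1.2) (p f.2.1) (c f.2.1 f.2.2) +
     (turns (p f.2.1) (p f.1.1) (c f.1.1 f.1.2) +
      turns (p f.2.2) (p f.1.1) (c f.1.1 f.1.2))) =
  \sum_(f <- fs)
    (upper (p f.1.1 - p f.2.1) + upper (p f.1.2 - p f.2.1) +
     (upper (p f.1.1 - p f.2.2) + upper (p f.1.2 - p f.2.2))) :> bool.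
Proof.
move=> hes hfs; apply: eq_big_seq => -[[i j] [k l]] /hfs /= [/hes [ci li] /hes [ck lk] h].
by have := turns_grid ci ck h; rewrite /= li lk.
Qed.

Lemma upper_oppr i j : p i != p j -> upper (p j - p i) = 1 + upper (p i - p j) :> bool.
Proof. by move/upper_opp ->; case: upper. Qed.

Lemma boolr_even (b : bool) : b *+ 2 = 0.
Proof. by case: b. Qed.

(** Summed over the 15 pairs of disjoint edges, [turns_grid] would equate an even and an odd number.
    Requiring [f.1.1 < f.2.1] counts each pair once. *)
Lemma no_K5_chains :
    (forall i j, (i < j < 5)%N -> path (nearby d) (p i) (c i j) /\ last (p i) (c i j) = p j) ->
    (forall i j k l, (i < j < 5)%N -> (k < l < 5)%N -> uniq [:: i; j; k; l] ->
       allrel (apart d) (p i :: c i j) (p k :: c k l)) ->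
    (forall i j, (i < j < 5)%N -> p i != p j) -> False.
Proof.
move=> hc hf hp.
pose es := [seq e <- [seq (i, j) | i <- iota 0 5, j <- iota 0 5] | (e.1 < e.2 < 5)%N].
pose fs := [seq f <- [seq (e, e') | e <- es, e' <- es] |
  (f.1.1 < f.2.1)%N && uniq [:: f.1.1; f.1.2; f.2.1; f.2.2]].
have hes e : e \in es -> path (nearby d) (p e.1) (c e.1 e.2) /\ last (p e.1) (c e.1 e.2) = p e.2.
  by rewrite mem_filter => /andP[h _]; apply: hc.
have hfs f : f \in fs -> [/\ f.1 \in es, f.2 \in es &
    allrel (apart d) (p f.1.1 :: c f.1.1 f.1.2) (p f.2.1 :: c f.2.1 f.2.2)].
  rewrite mem_filter => /andP[/andP[_ u] /allpairsP[[e e'] [/= he he' def_f]]].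
  rewrite def_f /= in u *; split=> //.
  by move: he he'; rewrite !mem_filter /= => /andP[? _] /andP[? _]; apply: hf.
(* Every term of the left-hand side occurs twice.  On the right-hand side every
   pair of vertices occurs an even number of times, in one of its two orders, and
   the reversed order occurs 15 = 1 + 2 * 7 times. *)
have := sum_turns_grid hes hfs.
set lhs := (X in X = _); set rhs := (X in _ = X).
have -> : lhs = (\sum_(e <- es) \sum_(v <- iota 0 5 | v \notin [:: e.1; e.2])
    turns (p v) (p e.1) (c e.1 e.2)) *+ 2.
  rewrite /lhs /fs /es /= !big_cons !big_nil /= ?inE /=.
  by ring.
have -> : rhs = 1 + (7 + \sum_(e <- es) upper (p e.1 - p e.2) *+ 3) *+ 2.
  rewrite /rhs /fs /es /= !big_cons !big_nil /=.
  have o i j ij := upper_oppr (hp i j ij).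
  rewrite ?((o 0 1 isT), (o 0 2 isT), (o 0 3 isT), (o 0 4 isT), (o 1 2 isT),
     (o 1 3 isT), (o 1 4 isT), (o 2 3 isT), (o 2 4 isT), (o 3 4 isT)).
  by ring.
by rewrite !boolr_even.
Qed.

Lemma no_K33_chains :
    (forall i j, (i < 3 <= j)%N -> (j < 6)%N ->
       path (nearby d) (p i) (c i j) /\ last (p i) (c i j) = p j) ->
    (forall i j k l, (i < 3 <= j)%N -> (j < 6)%N -> (k < 3 <= l)%N -> (l < 6)%N ->
       i != k -> j != l -> allrel (apart d) (p i :: c i j) (p k :: c k l)) ->
    (forall i j, (i < j < 6)%N -> p i != p j) -> False.
Proof.
move=> hc hf hp.
pose es := [seq (i, j) | i <- iota 0 3, j <- iota 3 3].
pose fs := [seq f <- [seq (e, e') | e <- es, e' <- es] |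
  (f.1.1 < f.2.1)%N && (f.1.2 != f.2.2)].
have es_lt e : e \in es -> (e.1 < 3 <= e.2)%N /\ (e.2 < 6)%N.
  by move=> he; apply/andP; move: e he; apply/allP.
have hes e : e \in es -> path (nearby d) (p e.1) (c e.1 e.2) /\ last (p e.1) (c e.1 e.2) = p e.2.
  by case/es_lt; apply: hc.
have hfs f : f \in fs -> [/\ f.1 \in es, f.2 \in es &
    allrel (apart d) (p f.1.1 :: c f.1.1 f.1.2) (p f.2.1 :: c f.2.1 f.2.2)].
  rewrite mem_filter => /andP[/andP[lt ne] /allpairsP[[e e'] [/= he he' def_f]]].
  rewrite def_f /= in lt ne *; split=> //.
  by have [? ?] := es_lt _ he; have [? ?] := es_lt _ he'; apply: hf; rewrite ?(ltn_eqF lt).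
(* As for [no_K5_chains], with 27 = 1 + 2 * 13 pairs in reversed order. *)
have := sum_turns_grid hes hfs.
set lhs := (X in X = _); set rhs := (X in _ = X).
have -> : lhs = (\sum_(e <- es) \sum_(v <- iota 0 6 | v \notin [:: e.1; e.2])
    turns (p v) (p e.1) (c e.1 e.2)) *+ 2.
  rewrite /lhs /fs /es /= !big_cons !big_nil /= ?inE /=.
  by ring.
pose es' : seq (nat * nat) := [:: (0, 1); (0, 2); (1, 2); (3, 4); (3, 5); (4, 5)].
have -> : rhs = 1 + (13 + (\sum_(e <- es) upper (p e.1 - p e.2) *+ 2 +
                         \sum_(e <- es') upper (p e.1 - p e.2) *+ 3)) *+ 2.
  rewrite /rhs /fs /es /es' /= !big_cons !big_nil /=.
  have o i j ij := upper_oppr (hp i j ij).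
  rewrite ?((o 0 1 isT), (o 0 2 isT), (o 0 3 isT), (o 0 4 isT), (o 0 5 isT),
     (o 1 2 isT), (o 1 3 isT), (o 1 4 isT), (o 1 5 isT), (o 2 3 isT), (o 2 4
     isT), (o 2 5 isT), (o 3 4 isT), (o 3 5 isT), (o 4 5 isT)).
  by ring.
by rewrite !boolr_even.
Qed.
End Obstruction.

(** * Discretizing a plane drawing *)

Section Discretization.
Local Open Scope classical_set_scope.
Local Open Scope ring_scope.
Variable R : realType.
Local Notation I := (`[0, 1]%classic : set R).
Implicit Types f g : R -> R * R.

Lemma square_inf_gt0 (F : R * R -> R) :
  {within (I `*` I)%classic, continuous F} ->
  (forall s t, s \in `[0, 1] -> t \in `[0, 1] -> 0 < F (s, t)) ->
  exists2 m, 0 < m & forall s t, s \in `[0, 1] -> t \in `[0, 1] -> m <= F (s, t).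
Proof.
move=> cF Fgt0; have in01 : (0 : R) \in `[0, 1] by rewrite in_itv /= lexx ler01.
have [||[s t] /set_mem [/= sI tI] minF] := compact_EVT_min _ _ cF.
- by exists (0, 0); split.
- by apply: compact_setX; apply: segment_compact.
exists (F (s, t)) => [|s' t' s'I t'I]; first exact: Fgt0.
by apply: minF; rewrite inE; split.
Qed.

Lemma within_fst f : {within I, continuous f} ->
  {within (I `*` I)%classic, continuous (fun z : R * R => f z.1)}.
Proof.
move=> /subspace_continuousP cf; apply/subspace_continuousP => -[s t] [/= sI tI].
apply: cvg_trans (cf s sI) => P /=; rewrite /nbhs /= /within /= => hP.
exists ([set x | I x -> P (f x)], setT)%classic => /=; first by split => //; exact: filterT.
by move=> [x y] [/= + _] [/= ? _]; apply.
Qed.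

Lemma within_snd f : {within I, continuous f} ->
  {within (I `*` I)%classic, continuous (fun z : R * R => f z.2)}.
Proof.
move=> /subspace_continuousP cf; apply/subspace_continuousP => -[s t] [/= sI tI].
apply: cvg_trans (cf t tI) => P /=; rewrite /nbhs /= /within /= => hP.
exists (setT, [set x | I x -> P (f x)])%classic => /=; first by split => //; exact: filterT.
by move=> [x y] [/= _ +] [/= _ ?]; apply.
Qed.

Lemma within_dist f g : {within I, continuous f} -> {within I, continuous g} ->
  {within (I `*` I)%classic, continuous (fun z : R * R => `|f z.1 - g z.2|)}.
Proof.
move=> cf cg z; apply: cvg_norm; apply: cvgB; first exact: within_fst.
exact: within_snd.
Qed.

Lemma apartE d (a b : R * R) : apart d a b = (2 * d < `|a - b|).
Proof. by rewrite [RHS]lt_max. Qed.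

Lemma nearbyE d (a b : R * R) : nearby d a b = (`|a - b| <= d).
Proof. by rewrite [RHS]ge_max. Qed.

Lemma arcs_apart f g : {within I, continuous f} -> {within I, continuous g} ->
  (forall s t, s \in `[0, 1] -> t \in `[0, 1] -> f s <> g t) ->
  exists2 d, 0 < d & forall s t, s \in `[0, 1] -> t \in `[0, 1] -> apart d (f s) (g t).
Proof.
move=> cf cg fg.
have [s t sI tI|m m0 hm] := square_inf_gt0 (within_dist cf cg).
  by rewrite normr_gt0 subr_eq0; apply/eqP/fg.
exists (m / 3); first by rewrite divr_gt0.
move=> s t sI tI; have {hm} := hm s t sI tI => /= hm.
by rewrite apartE; lra.
Qed.

Lemma apart_le d d' (a b : R * R) : d <= d' -> apart d' a b -> apart d a b.
Proof.
by rewrite !apartE => dd'; apply: le_lt_trans; rewrite ler_pM2l.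
Qed.

(** Uniform continuity by compactness: the maximum of [|s - t|] and [d - |f s - f t|] has a positive
    lower bound on the square, so the second is positive when the first is small. *)
Lemma arc_modulus f d : {within I, continuous f} -> 0 < d ->
  exists2 m, 0 < m & forall s t, s \in `[0, 1] -> t \in `[0, 1] ->
    `|s - t| < m -> nearby d (f s) (f t).
Proof.
move=> cf d0.
have [||m m0 hm] := @square_inf_gt0
  ((fun z => `|z.1 - z.2|) \max (fun z => d - `|f z.1 - f z.2|)).
- move=> z; apply: (@continuous_max _ (subspace _)) => /=.
    by apply: continuous_subspaceT => y; apply: cvg_norm; apply: cvgB;
      [exact: cvg_fst|exact: cvg_snd].
  by apply: cvgB; [exact: cvg_cst|exact: within_dist].
(* On the diagonal the second function is [d], off it the first one is positive. *)
- move=> s t _ _ /=; have [->|st] := eqVneq s t.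
    by rewrite !subrr !normr0 (subr0 d) lt_max d0 orbT.
  by rewrite lt_max normr_gt0 subr_eq0 st.
exists m => // s t sI tI st; have := hm s t sI tI; rewrite /= nearbyE le_max.
by rewrite leNgt st /=; lra.
Qed.

Lemma arc_chain f d : {within I, continuous f} -> 0 < d ->
  exists s : seq (R * R), [/\ path (nearby d) (f 0) s, last (f 0) s = f 1 &
    forall a, a \in f 0 :: s -> exists2 t, t \in `[0, 1] & a = f t].
Proof.
move=> cf d0; have [m m0 hm] := arc_modulus cf d0.
have [n /= n0 nm] : exists2 n : nat, (0 < n)%N & n%:R^-1 < m.
  have := archi_boundP (ltW (divr_gt0 ltr01 m0)); set n := Num.bound _ => hn.
  have n0 : (0 : R) < n%:R by apply: lt_trans hn; rewrite divr_gt0.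
  exists n; first by rewrite -(ltr0n R).
  by rewrite invf_plt ?posrE // -div1r.
have n0R : (0 : R) < n%:R by rewrite ltr0n.
have inI k : (k <= n)%N -> (k%:R / n%:R : R) \in `[0, 1].
  by move=> kn; rewrite in_itv /= divr_ge0 ?ler0n //= ler_pdivrMr // mul1r ler_nat.
pose g k := f (k%:R / n%:R).
have g0 : f 0 = g 0%N by rewrite /g mul0r.
have gn : f 1 = g n by rewrite /g divff // lt0r_neq0.
exists [seq g k | k <- iota 1 n]; split.
- rewrite g0 path_map.
  have : (0 + n <= n)%N by [].
  elim: {1 3}n 0%N => //= k IHk i ikn; rewrite IHk ?addSnnS // andbT.
  apply: hm; [apply: inI; lia|apply: inI; lia|].
  by rewrite -mulrBl -natr1 opprD addNKr mulN1r normrN ger0_norm ?invr_ge0 ?ler0n.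
- by rewrite g0 gn last_map -nth_last size_iota nth_iota ?prednK // add1n prednK.
move=> a; rewrite in_cons => /predU1P[->|/mapP[k]].
  by exists 0 => //; rewrite in_itv /= lexx ler01.
rewrite mem_iota add1n ltnS => /andP[_ kn] ->; exists (k%:R / n%:R) => //; exact: inI.
Qed.

Lemma uniform_gt0 (T : finType) (P : R -> T -> Prop) :
    (forall d d' x, d <= d' -> P d' x -> P d x) ->
    (forall x, exists2 d, 0 < d & P d x) ->
  exists2 d, 0 < d & forall x, P d x.
Proof.
move=> mono ex; have [d d0 dP] : exists2 d : T -> R, forall x, 0 < d x & forall x, P (d x) x.
  by have /choice[d dP] : forall x, exists d, 0 < d /\ P d x;
    [move=> x; have [d ? ?] := ex x; exists d|exists d => x; case: (dP x)].
exists (\big[Num.min/1]_x d x) => [|x]; last by apply: mono (dP x); apply: bigmin_le_cond.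
by elim/big_ind: _ => // x y x0 y0; rewrite lt_min x0.
Qed.

End Discretization.

(** The drawing enters the rest of the proof only through these finite chains. A separation [d]
    common to all pairs of disjoint edges is chosen first; every edge is then sampled with steps of
    size at most [d]. *)
Lemma planar_chains (R : realType) (V : finType) (E : rel V) : planar R E ->
  exists (d : R) (pos : V -> R * R) (c : V -> V -> seq (R * R)),
  [/\ injective pos,
      forall u v, E u v -> path (nearby d) (pos u) (c u v) /\ last (pos u) (c u v) = pos v &
      forall u v x y, E u v -> E x y -> [&& u != x, u != y, v != x & v != y] ->
        allrel (apart d) (pos u :: c u v) (pos x :: c x y)].
Proof.
case=> pos [arc drawn]; have arcs_meet u v x y : E u v -> E x y ->
    [&& u != x, u != y, v != x & v != y] ->
    forall s t, s \in `[0, 1] -> t \in `[0, 1] -> arc u v s <> arc x y t.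
  move=> uv xy dis s t.
  have end_or r : r \in `[0, 1] -> r = 0 \/ r = 1 \/ r \in `]0, 1[.
    rewrite !in_itv /= => /andP[]; rewrite !le_eqVlt => /predU1P[->|->]; first by left.
    by case/predU1P=> [->|->]; right; [left|right].
  have ne a b : a != b -> pos a <> pos b by move=> ab /(pos_inj drawn)/eqP; apply/negP.
  have ne1 : [set u; v]%SET <> [set x; y]%SET.
    by move/setP/(_ u); rewrite !inE eqxx; case/and3P: dis => /negPf -> /negPf ->.
  case/and4P: dis => ux uy vx vy.
  case/end_or=> [->|[->|s01]] /end_or[->|[->|t01]];
    rewrite ?(arc_start drawn uv) ?(arc_start drawn xy) ?(arc_end drawn uv) ?(arc_end drawn xy);
    do ?[exact: ne].
  - by apply/nesym; apply: (arc_avoids_vertices drawn).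
  - by apply/nesym; apply: (arc_avoids_vertices drawn).
  - by apply: (arc_avoids_vertices drawn).
  - by apply: (arc_avoids_vertices drawn).
  by apply: (arc_avoids_arcs drawn).
have [| |d d0 dP] := @uniform_gt0 R (V * V * (V * V))%type (fun d e =>
  E e.1.1 e.1.2 -> E e.2.1 e.2.2 ->
  [&& e.1.1 != e.2.1, e.1.1 != e.2.2, e.1.2 != e.2.1 & e.1.2 != e.2.2] ->
  forall s t, s \in `[0, 1] -> t \in `[0, 1] ->
  apart d (arc e.1.1 e.1.2 s) (arc e.2.1 e.2.2 t)).
- by move=> d d' e dd' + uv xy dis s t sI tI => /(_ uv xy dis s t sI tI); apply: apart_le.
- case=> [[u v] [x y]] /=.
  have [uv|/negP uv] := boolP (E u v); last by exists 1.
  have [xy|/negP xy] := boolP (E x y); last by exists 1.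
  have [dis|/negP dis] := boolP [&& u != x, u != y, v != x & v != y]; last by exists 1.
  have [d d0 dP] := arcs_apart (arc_continuous drawn uv) (arc_continuous drawn xy)
    (arcs_meet _ _ _ _ uv xy dis).
  by exists d.
have /choice[c cP] : forall e : V * V, exists s : seq (R * R), E e.1 e.2 ->
    [/\ path (nearby d) (arc e.1 e.2 0) s, last (arc e.1 e.2 0) s = arc e.1 e.2 1 &
    forall a, a \in arc e.1 e.2 0 :: s -> exists2 t, t \in `[0, 1] & a = arc e.1 e.2 t].
  case=> u v /=; have [uv|/negP uv] := boolP (E u v); last by exists [::].
  by have [s sP] := arc_chain (arc_continuous drawn uv) d0; exists s.
exists d, pos, (fun u v => c (u, v)); split; first exact: pos_inj drawn.
  move=> u v uv; have [] := cP (u, v) uv.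
  by rewrite /= (arc_start drawn uv) (arc_end drawn uv).
move=> u v x y uv xy dis; have [_ _ cuv] := cP (u, v) uv; have [_ _ cxy] := cP (x, y) xy.
apply/allrelP => a b; rewrite -(arc_start drawn uv) -(arc_start drawn xy).
move=> /cuv[s sI ->] /cxy[t tI ->]; exact: (dP ((u, v), (x, y))).
Qed.

From mathcomp Require Import fintype finset bigop.

(** * Minors of planar graphs *)

Section Minors.
Variables (V : finType) (E : rel V).
Implicit Types (A B : {set V}) (F : rel V) (b : V -> {set V}).

Definition inside B : rel V := [rel u w | [&& E u w, u \in B & w \in B]].

Definition connected_set B := {in B &, forall u w, connect (inside B) u w}.

(* [b x] is the branch set of the vertex [x] of the minor, whose vertex set is
   [A] and whose edges are given by [F]. *)
Definition minor_model A F b :=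
  [/\ {in A, forall x, b x != set0},
      {in A, forall x, connected_set (b x)},
      {in A &, forall x y, x != y -> [disjoint b x & b y]} &
      {in A &, forall x y, F x y -> exists u w, [/\ u \in b x, w \in b y & E u w]}].

Lemma connect_inside_walk B u w : u \in B -> connect (inside B) u w ->
  exists2 q, path E u q & last u q = w /\ {subset u :: q <= B}.
Proof.
move=> uB /connectP[q]; elim: q u uB => [|v q IHq] u uB /=.
  by move=> _ ->; exists [::] => //; split=> // x; rewrite inE => /eqP->.
case/andP=> /and3P[uv _ vB] /(IHq v vB) {}IHq /IHq[q' pq' [lq' sq']].
exists (v :: q') => /=; first by rewrite uv.
by split=> // x; rewrite inE => /predU1P[->|/sq'].
Qed.

Lemma connect_insideS B B' u w : B \subset B' ->
  connect (inside B) u w -> connect (inside B') u w.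
Proof.
move=> sB; apply: connect_sub => x y /and3P[xy xB yB].
by apply: connect1; rewrite /inside /= xy !(subsetP sB).
Qed.

End Minors.

(** * No K_{3,3} subgraph and no K_5 minor *)

Section PlanarMinors.
Variables (R : realType) (V : finType) (E : rel V).
Hypothesis planarE : planar R E.

Lemma planar_no_K33 (s : seq V) : size s = 6%N -> uniq s ->
  (forall x y, x \in take 3 s -> y \in drop 3 s -> E x y) -> False.
Proof.
have [d [pos [c [pos_inj hc hf]]]] := planar_chains planarE.
case: s => // v0 s0; set s := v0 :: s0 => sz us edge; pose v i := nth v0 s i.
have adj i j : (i < 3 <= j)%N -> (j < 6)%N -> E (v i) (v j).
  move=> /andP[i3 j3] j6; apply: edge.
    by rewrite /v -(nth_take v0 i3) mem_nth // size_take sz.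
  by rewrite /v -(subnKC j3) -nth_drop mem_nth // size_drop sz; lia.
have vneq i j : (i < 6)%N -> (j < 6)%N -> i != j -> v i != v j.
  by move=> i6 j6; rewrite nth_uniq ?sz.
apply: (@no_K33_chains _ d (pos \o v) (fun i j => c (v i) (v j))) => /=.
- by move=> i j i3 j6; apply: hc; apply: adj.
- move=> i j k l i3 j6 k3 l6 ik jl; apply: hf; [exact: adj|exact: adj|].
  by apply/and4P; split; apply: vneq; lia.
- by move=> i j ij; apply/eqP => /pos_inj/eqP; apply/negP/vneq; lia.
Qed.


(** Each branch set gets a representative, and two of them are joined by the drawing of a walk
    inside the union of their branch sets. A walk may cross itself, but the walks of disjoint edges
    of [K_5] use disjoint vertex sets, so their chains stay apart. *)
Lemma planar_no_K5 A F b (s : seq V) : minor_model E A F b ->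
  size s = 5%N -> uniq s -> {subset s <= A} ->
  {in s &, forall x y, x != y -> F x y} -> False.
Proof.
have [d [pos [c [pos_inj hc hf]]]] := planar_chains planarE.
case=> b_n0 b_conn b_dis b_adj.
case: s => // v0 s0; set s := v0 :: s0 => sz us sA sF; pose v i := nth v0 s i.
have vs i : (i < 5)%N -> v i \in s by move=> i5; rewrite mem_nth ?sz.
have vneq i j : (i < 5)%N -> (j < 5)%N -> i != j -> v i != v j.
  by move=> i5 j5; rewrite nth_uniq ?sz.
have /choice[r rP] : forall i, exists u, (i < 5)%N -> u \in b (v i).
  move=> i; have [i5|i5] := boolP (i < 5)%N; last by exists v0.
  by have [u ub] := set0Pn _ (b_n0 _ (sA _ (vs i i5))); exists u.
(* The walk is nonempty, so that even its first point lies on the chain of an edge. *)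
have link i j : (i < j < 5)%N -> exists q, [/\ path E (r i) q, last (r i) q = r j,
    q != [::] & {subset r i :: q <= b (v i) :|: b (v j)}].
  move=> ij; have [i5 j5] : (i < 5)%N /\ (j < 5)%N by lia.
  have vij : v i != v j by apply: vneq => //; lia.
  have [iA jA] := (sA _ (vs i i5), sA _ (vs j j5)).
  have [x [y [xb yb xy]]] := b_adj _ _ iA jA (sF _ _ (vs i i5) (vs j j5) vij).
  have [q1 p1 [l1 s1]] := connect_inside_walk (rP i i5) (b_conn _ iA _ _ (rP i i5) xb).
  have [q2 p2 [l2 s2]] := connect_inside_walk yb (b_conn _ jA _ _ yb (rP j j5)).
  exists (q1 ++ y :: q2); split; rewrite ?cat_path ?last_cat /= ?l1 ?p1 ?xy //.
    by case: q1 {p1 l1 s1}.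
  move=> z; rewrite -cat_cons mem_cat in_setU => /orP[/s1 ->|/s2 ->] //; exact: orbT.
pose fix chain u q := if q is w :: q' then c u w ++ chain w q' else [::].
have chainP u q : path E u q -> path (nearby d) (pos u) (chain u q) /\
    last (pos u) (chain u q) = pos (last u q).
  elim: q u => //= w q IHq u /andP[uw /IHq[pq lq]]; have [puw luw] := hc _ _ uw.
  by rewrite cat_path last_cat puw luw.
have chain_mem u q a : path E u q -> a \in chain u q -> exists x y,
    [/\ E x y, x \in u :: q, y \in u :: q & a \in pos x :: c x y].
  elim: q u => //= w q IHq u /andP[uw pq]; rewrite mem_cat => /orP[auw|/(IHq _ pq)].
    exists u, w; split=> //; first exact: mem_head.
      by rewrite in_cons mem_head orbT.
    by rewrite in_cons auw orbT.
  by case=> x [y [xy xq yq axy]]; exists x, y; split; rewrite // in_cons ?xq ?yq orbT.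
have chain_mem0 u q a : q != [::] -> path E u q -> a \in pos u :: chain u q -> exists x y,
    [/\ E x y, x \in u :: q, y \in u :: q & a \in pos x :: c x y].
  case: q => // w q _ puq; rewrite inE => /predU1P[->|/(chain_mem _ _ _ puq)//].
  by exists u, w; case/andP: puq => uw _; split; rewrite ?mem_head // in_cons mem_head orbT.
have /choice[k kP] : forall e : nat * nat, exists q, (e.1 < e.2 < 5)%N ->
    [/\ path E (r e.1) q, last (r e.1) q = r e.2,
    q != [::] & {subset r e.1 :: q <= b (v e.1) :|: b (v e.2)}].
  case=> i j /=; have [ij|/negP ij] := boolP (i < j < 5)%N; last by exists [::].
  by have [q] := link i j ij; exists q.
apply: (@no_K5_chains _ d (pos \o r) (fun i j => chain (r i) (k (i, j)))) => /=.
- by move=> i j ij; have [pk lk _ _] := kP (i, j) ij; rewrite -lk; apply: chainP.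
- move=> i j i' j' ij ij' u; have [pk _ nk sk] := kP (i, j) ij.
  have [pk' _ nk' sk'] := kP (i', j') ij'.
  apply/allrelP => a a' /(chain_mem0 _ _ _ nk pk)[x [y [xy /sk xb /sk yb axy]]].
  move=> /(chain_mem0 _ _ _ nk' pk')[x' [y' [xy' /sk' xb' /sk' yb' axy']]].
  have dis z z' : z \in b (v i) :|: b (v j) -> z' \in b (v i') :|: b (v j') -> z != z'.
    move=> zb zb'; apply: contraTneq zb' => <-; move: zb.
    have bdis l l' : (l < 5)%N -> (l' < 5)%N -> l != l' -> z \in b (v l) -> z \notin b (v l').
      move=> l5 l5' ll' zl; rewrite (disjointFr (b_dis _ _ _ _ _) zl) //; try exact/sA/vs.
      exact: vneq.
    move: u; rewrite /= !inE !negb_or => /and3P[/and3P[? ? ?] /andP[? ?] _].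
    move: ij ij' => /andP[lij j5] /andP[lij' j5'].
    have [i5 i5'] := (ltn_trans lij j5, ltn_trans lij' j5').
    by move=> /orP[] zb; apply/andP; split; apply: bdis zb.
  have ne4 : [&& x != x', x != y', y != x' & y != y'] by apply/and4P; split; apply: dis.
  by have /allrelP := hf x y x' y' xy xy' ne4; apply.
move=> i j ij; apply/eqP => /pos_inj rij; have [i5 j5] : (i < 5)%N /\ (j < 5)%N by lia.
have vij : v i != v j by apply: vneq => //; lia.
have := disjointFr (b_dis _ _ (sA _ (vs i i5)) (sA _ (vs j j5)) vij) (rP i i5).
by rewrite rij (rP j j5).
Qed.
End PlanarMinors.

(** * Mader's edge bound for graphs without K_5 minor *)

Section EdgeBound.
Local Open Scope nat_scope.
Variables (V : finType) (E : rel V).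
Hypothesis symE : symmetric E.
Implicit Types (A : {set V}) (F : rel V) (b : V -> {set V}).

(* Edges are counted once for each orientation. *)
Definition arcs A F : {set V * V} :=
  [set p | [&& p.1 \in A, p.2 \in A & F p.1 p.2]].

Definition nbrs A F x : {set V} := [set y in A | F x y].

Lemma sum_nbrs A F : \sum_(x in A) #|nbrs A F x| = #|arcs A F|.
Proof.
rewrite -sum1_card (eq_bigl (fun p : V * V => (p.1 \in A) && ((p.2 \in A) && F p.1 p.2))).
  rewrite -(pair_big_dep (mem A) (fun x y => (y \in A) && F x y) (fun _ _ => 1)) /=.
  by apply: eq_bigr => x _; rewrite -sum1_card; apply: eq_bigl => y; rewrite inE.
by move=> p; rewrite inE.
Qed.

Lemma minor_modelS A A' F F' b : A' \subset A ->
  {in A' &, forall x y, F' x y -> F x y} ->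
  minor_model E A F b -> minor_model E A' F' b.
Proof.
move=> sA sF [h1 h2 h3 h4]; have sA' := subsetP sA; split.
- by move=> x /sA'; apply: h1.
- by move=> x /sA'; apply: h2.
- by move=> x y /sA' xA /sA' yA; apply: h3.
by move=> x y xA yA /(sF _ _ xA yA); apply: h4; apply: sA'.
Qed.

(** [x] is contracted into [y] and has to be removed from the vertex set separately. The tests
    [w != y] and [z != y] prevent a loop at [y]. *)
Definition contract F x y : rel V := fun z w =>
  [|| F z w, [&& z == y, F x w & w != y] | [&& w == y, F x z & z != y]].

Definition merge b x y : V -> {set V} := fun z => if z == y then b y :|: b x else b z.

Lemma minor_model_contract A F b x y : symmetric F ->
    x \in A -> y \in A -> x != y -> F x y ->
  minor_model E A F b -> minor_model E (A :\ x) (contract F x y) (merge b x y).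
Proof.
move=> symF xA yA xy Fxy [b_n0 b_conn b_dis b_adj].
have [u [w [ux wy uw]]] := b_adj _ _ xA yA Fxy.
have sin B : symmetric (inside E B).
  by move=> s t; rewrite /inside /= symE [X in _ && X]andbC.
split.
- move=> z /setD1P[_ zA]; rewrite /merge; case: (z =P y) => _; last exact: b_n0.
  by apply/set0Pn; exists w; rewrite inE wy.
- move=> z /setD1P[_ zA]; rewrite /merge; case: (z =P y) => _; last exact: b_conn.
  pose B := b y :|: b x.
  (* Everything in the union is connected to [w], the end in [b y] of an edge between the two branch
     sets. *)
  have toW s : s \in B -> connect (inside E B) s w.
    rewrite inE => /orP[sy|sx].
      exact: connect_insideS (subsetUl _ _) (b_conn _ yA _ _ sy wy).
    apply: connect_trans (connect_insideS (subsetUr _ _) (b_conn _ xA _ _ sx ux)) _.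
    by apply: connect1; rewrite /inside /= uw !inE ux wy orbT.
  move=> s t sB tB; apply: connect_trans (toW s sB) _.
  by rewrite (sym_connect_sym (sin _)) toW.
- have dis z : z \in A -> z != x -> z != y -> [disjoint b y :|: b x & b z].
    by move=> zA zx zy; rewrite -setI_eq0 setIUl setU_eq0 !setI_eq0 !b_dis // eq_sym.
  move=> z z' /setD1P[zx zA] /setD1P[zx' zA'] zz'; rewrite /merge.
  case: (eqVneq z y) (eqVneq z' y) => [ezy|zy] [ezy'|zy'].
  + by rewrite ezy ezy' eqxx in zz'.
  + exact: dis.
  + by rewrite disjoint_sym; apply: dis.
  exact: b_dis.
have sub z : b z \subset merge b x y z.
  by rewrite /merge; case: eqP => [->|_] //; apply: subsetUl.
have adj z z' : z \in A -> z' \in A -> F z z' -> exists s t,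
    [/\ s \in merge b x y z, t \in merge b x y z' & E s t].
  move=> zA zA' /(b_adj _ _ zA zA')[s [t [sz tz st]]].
  by exists s, t; rewrite !(subsetP (sub _)).
have adjy z : z \in A -> z != y -> F x z -> exists s t,
    [/\ s \in merge b x y y, t \in merge b x y z & E s t].
  move=> zA zy /(b_adj _ _ xA zA)[s [t [sx tz st]]]; exists s, t.
  by rewrite /merge eqxx (negPf zy) inE sx orbT.
move=> z z' /setD1P[_ zA] /setD1P[_ zA'] /or3P[|/and3P[/eqP-> Fxz zy]|/and3P[/eqP-> Fxz zy]].
- exact: adj.
- exact: adjy.
have [s [t [sy tz st]]] := adjy z zA zy Fxz.
by exists t, s; rewrite symE.
Qed.

Lemma arcsD1 A F x : symmetric F ->
  #|arcs A F| <= #|arcs (A :\ x) F| + #|nbrs A F x|.*2.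
Proof.
move=> symF; rewrite -addnn addnA.
have -> : #|nbrs A F x| = #|setX [set x] (nbrs A F x)| by rewrite cardsX cards1 mul1n.
have {2}-> : #|setX [set x] (nbrs A F x)| = #|setX (nbrs A F x) [set x]|.
  by rewrite !cardsX mulnC.
apply: leq_trans (leq_add (leq_card_setU _ _) (leqnn _)).
apply: leq_trans (leq_card_setU _ _); apply/subset_leq_card/subsetP => -[z w].
rewrite !inE /= => /and3P[zA wA Fzw].
case: (eqVneq z x) Fzw => [-> ->|_ Fzw]; first by rewrite wA ?orbT.
by case: (eqVneq w x) Fzw => [-> Fzx|_ ->]; rewrite ?(symF x) ?Fzx zA ?wA ?orbT.
Qed.

(** Each neighbor of [x] that is neither [y] nor adjacent to [y] becomes a new neighbor of [y],
    which gives two arcs. *)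
Lemma arcs_contract A F x y : symmetric F -> irreflexive F -> y \in A -> x != y ->
  #|arcs (A :\ x) F| + #|nbrs A F x :\ y :\: nbrs A F y|.*2
    <= #|arcs (A :\ x) (contract F x y)|.
Proof.
move=> symF irrF yA xy; set W := nbrs A F x :\ y :\: nbrs A F y.
rewrite -addnn addnA.
have {1}-> : #|W| = #|setX [set y] W| by rewrite cardsX cards1 mul1n.
have -> : #|W| = #|setX W [set y]| by rewrite cardsX cards1 muln1.
have /leqifP := leq_card_setU (arcs (A :\ x) F) (setX [set y] W).
case: ifPn => [_ /eqP <-|/negP[]]; last first.
  rewrite -setI_eq0; apply/eqP/setP => -[z w]; rewrite !inE /=.
  by case: (eqVneq z y) => [->|]; rewrite ?andbF //; case: (w \in A); case: (F y w); rewrite ?andbF.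
have /leqifP := leq_card_setU (arcs (A :\ x) F :|: setX [set y] W) (setX W [set y]).
case: ifPn => [_ /eqP <-|/negP[]]; last first.
  rewrite -setI_eq0; apply/eqP/setP => -[z w]; rewrite !inE /= (symF z).
  case: (eqVneq w y) => [->|]; rewrite ?andbF //= ?irrF ?eqxx ?andbF ?andFb ?orbF.
  by case: (z \in A); case: (F y z); rewrite ?andbF ?irrF.
apply/subset_leq_card/subsetP => -[z w]; rewrite !inE /contract /=.
have xx : F x x = false := irrF x.
case/orP=> [/orP[/and3P[-> -> ->]//|]|].
  case/andP=> /eqP-> /and3P[_ wy /andP[wA Fxw]].
  have wx : w != x by apply: contraTneq Fxw => ->; rewrite xx.
  by rewrite eqxx yA wA wy Fxw wx (eq_sym y) xy /= !orbT.
case/andP=> /and3P[_ zy /andP[zA Fxz]] /eqP->.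
have zx : z != x by apply: contraTneq Fxz => ->; rewrite xx.
by rewrite eqxx yA zA zy Fxz zx (eq_sym y) xy /= !orbT.
Qed.

Hypothesis noK5 : forall A F b (s : seq V), minor_model E A F b ->
  size s = 5 -> uniq s -> {subset s <= A} ->
  {in s &, forall x y, x != y -> F x y} -> False.

Lemma noK5_nbrs A F b v (K : {set V}) : minor_model E A F b -> symmetric F -> irreflexive F ->
  v \in A -> K \subset nbrs A F v -> #|K| = 4 -> {in K &, forall x y, x != y -> F x y} -> False.
Proof.
move=> model symF irrF vA sK K4 FK.
have vK x : x \in K -> x \in A /\ F v x by move/(subsetP sK); rewrite inE => /andP[].
have vnK : v \notin K by apply/negP => /vK[_]; rewrite irrF.
apply: (@noK5 A F b (v :: enum K) model) => /=; first by rewrite -cardE K4.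
- by rewrite mem_enum vnK enum_uniq.
- by move=> x; rewrite inE mem_enum => /predU1P[->//|/vK[]].
move=> x y; rewrite !inE !mem_enum => /predU1P[->|xK] /predU1P[->|yK]; rewrite ?eqxx //.
- by case: (vK y).
- by rewrite symF; case: (vK x).
exact: FK.
Qed.

(* Among five neighbors, those that are not adjacent form a matching.  If the
   matching has two edges [c d] and [x y], then contracting the edge [c x]
   leaves four pairwise adjacent neighbors. *)
Lemma noK5_degree_gt5 A F b v : minor_model E A F b -> symmetric F -> irreflexive F -> v \in A ->
    3 < #|nbrs A F v| ->
    {in nbrs A F v, forall y, 2 < #|nbrs A F v :&: nbrs A F y|} ->
  5 < #|nbrs A F v|.
Proof.
move=> model symF irrF vA; set N := nbrs A F v => N3 common; rewrite ltnNge; apply/negP => N5.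
have NA y : y \in N -> y \in A by rewrite inE => /andP[].
have Fv y : y \in N -> F v y by rewrite inE => /andP[].
have subN y z : y \in N -> z \in N -> ~~ F y z -> N :&: nbrs A F y \subset N :\ y :\ z.
  move=> yN zN yz; apply/subsetP => t; rewrite in_setI => /andP[tN].
  rewrite inE => /andP[_ yt]; rewrite !in_setD1 tN andbT; apply/andP; split.
    by apply: contraTneq yt => ->.
  by apply: contraTneq yt => ->; rewrite irrF.
(* A vertex with two nonneighbors in [N] would keep at most two common neighbors with [v], since [N]
   has at most five elements. *)
have uniq_nonnbr y z z' : y \in N -> z \in N -> z' \in N -> y != z -> y != z' ->
    ~~ F y z -> ~~ F y z' -> z = z'.
  move=> yN zN zN' yz yz' Fyz Fyz'; apply/eqP; apply: contraTT (common y yN) => zz'.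
  have /subset_leq_card : N :&: nbrs A F y \subset N :\ y :\ z :\ z'.
    apply/subsetP => t tN; rewrite in_setD1 (subsetP (subN y z yN zN Fyz)) // andbT.
    by apply: contraTneq tN => ->; rewrite !inE (negPf Fyz') !andbF.
  have := cardsD1 y N; have := cardsD1 z (N :\ y); have := cardsD1 z' (N :\ y :\ z).
  by rewrite !in_setD1 yN zN zN' (eq_sym z' z) (eq_sym z y) (eq_sym z' y) yz yz' zz' /=; lia.
have [N4|N4] := leqP #|N| 4.
  apply: (@noK5_nbrs A F b v N) => //; first by apply/eqP; rewrite eqn_leq N4.
  move=> y z yN zN yz; apply: contraTT (common y yN) => Fyz.
  have := subset_leq_card (subN y z yN zN Fyz).
  have := cardsD1 y N; have := cardsD1 z (N :\ y).
  by rewrite !in_setD1 yN zN eq_sym yz /=; lia.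
have card1 c : c \in N -> #|N :\ c| = 4 by have := cardsD1 c N => + cN; rewrite cN; lia.
have nonadj c : c \in N -> exists y z, [/\ y \in N :\ c, z \in N :\ c, y != z & ~~ F y z].
  move=> cN; have [/existsP[[y z] /= /and4P[*]]|none] :=
    boolP [exists p : V * V, [&& p.1 \in N :\ c, p.2 \in N :\ c, p.1 != p.2 & ~~ F p.1 p.2]].
    by exists y, z.
  case: (@noK5_nbrs A F b v (N :\ c)) => //; [exact: subsetDl|exact: card1|].
  move=> y z yK zK yz; apply: contraNT none => Fyz; apply/existsP; exists (y, z).
  by rewrite /= yK zK yz.
have [w wN] : exists w, w \in N by apply/set0Pn; rewrite -card_gt0; lia.
have [c [d [/setD1P[_ cN] /setD1P[_ dN] cd Fcd]]] := nonadj w wN.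
have [x [y [/setD1P[xc xN] /setD1P[yc yN] xy Fxy]]] := nonadj c cN.
have xd : x != d.
  apply: contra_neq (yc) => xd; apply: (uniq_nonnbr x y c xN yN cN xy xc Fxy).
  by rewrite xd symF.
have yd : y != d.
  apply: contra_neq (xc) => yd; apply: (uniq_nonnbr y x c yN xN cN _ yc).
  - by rewrite eq_sym.
  - by rewrite symF.
  by rewrite yd symF.
have nonnbr_c z : z \in N -> z != c -> z != d -> F c z.
  move=> zN zc zd; apply: contraNT zd => Fcz; apply/eqP.
  by apply: (@uniq_nonnbr c z d) => //; rewrite eq_sym.
have model' : minor_model E (A :\ c) (contract F c x) (merge b c x).
  apply: minor_model_contract (symF) (NA _ cN) (NA _ xN) _ _ model; first by rewrite eq_sym.
  exact: nonnbr_c.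
have cv : v != c by apply: contraTneq (Fv c cN) => <-; rewrite irrF.
have symC : symmetric (contract F c x).
  by move=> s t; rewrite /contract symF; congr (_ || _); rewrite orbC.
have irrC : irreflexive (contract F c x).
  by move=> s; rewrite /contract irrF /= orbb; case: eqP => //= _; rewrite andbF.
apply: (noK5_nbrs model' symC irrC (v := v) (K := N :\ c)).
- by rewrite !inE cv.
- apply/subsetP => z; rewrite in_setD1 => /andP[zc zN].
  by rewrite !inE zc (NA _ zN) /contract (Fv _ zN).
- exact: card1.
move=> s t /setD1P[sc sN] /setD1P[tc tN] st; rewrite /contract.
have [//|Fst /=] := boolP (F s t).
have only p q z : p \in N -> q \in N -> z \in N ->
    p != q -> z != p -> ~~ F p q -> ~~ F z p -> z = q.
  move=> pN qN zN pq zp Fpq Fzp; apply: (uniq_nonnbr p z q pN zN qN _ pq _ Fpq).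
  - by rewrite eq_sym.
  - by rewrite symF.
have [ts Fts] : t != s /\ ~~ F t s by rewrite eq_sym symF.
have [yx Fyx] : y != x /\ ~~ F y x by rewrite eq_sym symF.
have [dc Fdc] : d != c /\ ~~ F d c by rewrite eq_sym symF.
have [sx|nsx] := eqVneq s x.
  rewrite sx in st ts Fst Fts *.
  by rewrite (only x y t xN yN tN xy ts Fxy Fts) (nonnbr_c y yN yc yd) yx.
have [tx|ntx] := eqVneq t x.
  rewrite tx in st ts Fst Fts *.
  by rewrite (only x y s xN yN sN xy st Fxy Fst) (nonnbr_c y yN yc yd).
have nsy : s != y.
  by apply: contra_neq (ntx) => sy; apply: (only y x t) => //; rewrite -sy.
have nty : t != y.
  by apply: contra_neq (nsx) => ty; apply: (only y x s) => //; rewrite -ty.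
have nsd : s != d.
  by apply: contra_neq (tc) => sd; apply: (only d c t) => //; rewrite -sd.
have ntd : t != d.
  by apply: contra_neq (sc) => td; apply: (only d c s) => //; rewrite -td.
(* A third nonadjacent pair would bring the number of neighbors to six. *)
have : size [:: s; t; x; y; c; d] <= size (enum N).
  apply: uniq_leq_size => [|z].
    by rewrite /= !inE !negb_or st nsx nsy sc nsd ntx nty tc ntd xy xc xd yc yd cd.
  by rewrite !inE mem_enum => /or4P[/eqP->|/eqP->|/eqP->|/or3P[/eqP->|/eqP->|/eqP->]].
by rewrite -cardE leqNgt ltnS N5.
Qed.

(* In a smallest counterexample every vertex has degree at least 4, some vertex
   [v] has degree at most 5, and every edge at [v] is in at least 3 triangles,
   since contracting it must remove more than 3 edges. *)
Lemma arcs_bound A F b : minor_model E A F b -> symmetric F -> irreflexive F ->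
  A != set0 -> #|arcs A F| + 4 <= 6 * #|A|.
Proof.
have [n] := ubnP #|A|; elim: n A F b => // n IHn A F b; rewrite ltnS => leAn.
have [m] := ubnP #|arcs A F|; elim: m F => // m IHm F; rewrite ltnS => ltm model symF irrF A0.
have A1 : 0 < #|A| by rewrite card_gt0.
rewrite leqNgt; apply/negP => big.
have cA v : v \in A -> #|A| = #|A :\ v|.+1 by move=> vA; rewrite (cardsD1 v) vA.
have del v : v \in A -> 3 < #|nbrs A F v|.
  move=> vA; rewrite ltnNge; apply/negP => dv; have := arcsD1 A v symF.
  have [AD0|AD0] := eqVneq (A :\ v) set0.
    have -> : nbrs A F v = set0.
      apply/setP => y; rewrite !inE; apply/negP => /andP[yA vy].
      have : y \in A :\ v by rewrite !inE yA andbT; apply: contraTneq vy => ->; rewrite irrF.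
      by rewrite AD0 inE.
    have -> : arcs (A :\ v) F = set0 by apply/setP => p; rewrite AD0 !inE.
    by rewrite !cards0; have := cA v vA; lia.
  have := IHn _ F b _ (minor_modelS _ _ model) symF irrF AD0.
  by have := cA v vA; move=> cAv /(_ _ (subsetDl _ _) (fun _ _ _ _ => id)); lia.
have [small|/forall_inPn[v vA]] := boolP [forall v in A, 5 < #|nbrs A F v|].
  have /set0Pn[v vA] := A0.
  have /set0Pn[y] : nbrs A F v != set0 by rewrite -card_gt0; have := del v vA; lia.
  rewrite inE => /andP[yA Fvy].
  (* All degrees being at least 6, there are at least [6 * #|A|] arcs; removing the two arcs of one
     edge leaves a counterexample with fewer arcs. *)
  pose F' : rel V := [rel s t | [&& F s t, (s, t) != (v, y) & (s, t) != (y, v)]].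
  have symF' : symmetric F'.
    move=> s t; rewrite /F' /= symF !xpair_eqE; congr (_ && _); rewrite andbC.
    by rewrite [(_ == v) && _]andbC [(_ == y) && _]andbC.
  have irrF' : irreflexive F' by move=> s; rewrite /F' /= irrF.
  have le2 : #|arcs A F| <= #|arcs A F'| + 2.
    have : arcs A F \subset arcs A F' :|: [set (v, y); (y, v)].
      apply/subsetP => -[s t]; rewrite !inE /F' /= => /and3P[-> -> ->] /=.
      by case: (_ == _); case: (_ == _).
    move/subset_leq_card/leq_trans; apply; apply: leq_trans (leq_card_setU _ _) _.
    by rewrite leq_add2l cards2; case: (_ != _).
  have lt1 : #|arcs A F'| < #|arcs A F|.
    apply/proper_card/properP; split.
      by apply/subsetP => p; rewrite !inE => /and4P[-> -> ->].
    by exists (v, y); rewrite !inE /F' /= vA yA Fvy // eqxx andbF.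
  have := IHm F' (leq_trans lt1 ltm) (minor_modelS (subxx _) _ model) symF' irrF' A0.
  have : 6 * #|A| <= #|arcs A F|.
    rewrite -sum_nbrs mulnC -sum_nat_const; apply: leq_sum => x xA.
    by move/forall_inP: small; apply.
  by move=> ? /(_ (fun _ _ _ _ => ltac:(by case/and3P))); lia.
apply/negP/negPn; apply: (noK5_degree_gt5 model symF irrF vA (del v vA)) => y.
rewrite inE => /andP[yA Fvy]; rewrite ltnNge; apply/negP => cy.
have vy : v != y by apply: contraTneq Fvy => ->; rewrite irrF.
have yAv : y \in A :\ v by rewrite !inE eq_sym vy.
have ltAn : #|A :\ v| < n by have := cA v vA; lia.
have symC : symmetric (contract F v y).
  by move=> s t; rewrite /contract symF; congr (_ || _); rewrite orbC.
have irrC : irreflexive (contract F v y).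
  by move=> s; rewrite /contract irrF /= orbb; case: eqP => //= _; rewrite andbF.
have AD0 : A :\ v != set0 by apply/set0Pn; exists y.
have := IHn _ _ _ ltAn (minor_model_contract symF vA yA vy Fvy model) symC irrC AD0.
have := arcs_contract symF irrF yA vy; have := arcsD1 A v symF; have := cA v vA.
set W := nbrs A F v :\ y :\: _.
have : #|nbrs A F v| <= #|W| + 1 + #|nbrs A F v :&: nbrs A F y|.
  rewrite -(cards1 y); apply: leq_trans (leq_add (leq_card_setU _ _) (leqnn _)).
  apply: leq_trans (leq_card_setU _ _); apply/subset_leq_card/subsetP => z.
  rewrite !inE => /andP[-> ->]; rewrite !andbT /=.
  by case: (z == y); case: (F y z).
by lia.
Qed.
End EdgeBound.

(** * Primal-dual algorithm *)

Section PrimalDual.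
Variables (R : realType) (q c : R) (L : nat) (T I : eqType).
Variables (members : I -> seq T) (elems : T -> seq I).

(* [value l i] is the dual variable of the element [i].  It starts at [c / q ^ L]
   and is multiplied by [q] in each of [L] steps, until a set containing [i] is
   tight; it then stays fixed. *)
Definition value (l : I -> nat) i : R := c * q ^+ l i / q ^+ L.

Definition load (l : I -> nat) v : R := \sum_(i <- elems v) value l i.

Definition tight (l : I -> nat) v : bool := q^-1 <= load l v.

Fixpoint level t : I -> nat :=
  if t is t'.+1 then fun i => (level t' i + ~~ has (tight (level t')) (members i))%N
  else fun=> 0%N.

Lemma level_succ t i :
  level t.+1 i = (level t i + ~~ has (tight (level t)) (members i))%N.
Proof. by []. Qed.

Hypotheses (q_gt1 : 1 < q) (c_ge0 : 0 <= c).

Let q_gt0 : 0 < q. Proof. exact: lt_trans q_gt1. Qed.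

Lemma value_ge0 l i : 0 <= value l i.
Proof. by rewrite divr_ge0 ?mulr_ge0 // exprn_ge0 // ltW. Qed.

Lemma value_le l l' i : (l i <= l' i)%N -> value l i <= value l' i.
Proof.
move=> ll; rewrite ler_pM2r ?invr_gt0 ?exprn_gt0 // ler_wpM2l //.
by rewrite ler_weXn2l // ltW.
Qed.

Lemma level_le t i : (level t i <= t)%N.
Proof. by elim: t => //= t IHt; case: has; rewrite /= ?addn0 ?addn1 // leqW. Qed.

Lemma tight_mono s t v : (s <= t)%N -> tight (level s) v -> tight (level t) v.
Proof.
elim: t => [|t IHt]; first by rewrite leqn0 => /eqP->.
rewrite leq_eqVlt => /predU1P[->//|/IHt{}IHt /IHt tv]; apply: le_trans tv _.
by apply: ler_sum => i _; apply: value_le; rewrite /= leq_addr.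
Qed.

Lemma level_untight t i : ~~ has (tight (level t)) (members i) -> level t i = t.
Proof.
elim: t => //= t IHt nt.
have nt' : ~~ has (tight (level t)) (members i).
  by apply: contra nt; apply: sub_has => v; apply: (@tight_mono t t.+1).
by rewrite IHt // nt' addn1.
Qed.

(** Feasibility of the dual solution: loads start at most 1 by the size bound, the elements of a
    tight set are frozen, and a load below [q^-1] grows by a factor of at most [q]. *)
Lemma load_le1 t v : (forall v i, i \in elems v -> v \in members i) ->
  (forall v, c * (size (elems v))%:R <= q ^+ L) -> load (level t) v <= 1.
Proof.
move=> hin hsize; elim: t v => [|t IHt] v.
  rewrite /load /value (eq_bigr (fun=> c / q ^+ L)) => [|i _]; last by rewrite expr0 mulr1.
  rewrite big_const_seq count_predT iter_addr addr0 -mulr_natr mulrAC.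
  by rewrite ler_pdivrMr ?exprn_gt0 // mul1r.
have [tv|ntv] := boolP (tight (level t) v).
  apply: le_trans (IHt v); rewrite /load big_seq [leRHS]big_seq.
  apply: ler_sum => i /hin vi; apply: value_le => /=.
  suff -> : has (tight (level t)) (members i) by rewrite addn0.
  by apply/hasP; exists v.
have : load (level t.+1) v <= q * load (level t) v.
  rewrite /load mulr_sumr; apply: ler_sum => i _; rewrite /value !mulrA (mulrC q).
  rewrite ler_pM2r ?invr_gt0 ?exprn_gt0 // -[c * q * _]mulrA -exprS ler_wpM2l //.
  by rewrite ler_weXn2l ?ltW //=; case: has; rewrite ?addn0 ?addn1.
move=> /le_trans; apply; move: ntv; rewrite -ltNge => /ltW.
by rewrite -(ler_pM2l q_gt0) divff ?gt_eqF.
Qed.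

End PrimalDual.

(** * The selected vertices *)

Section Algorithm.
Local Open Scope nat_scope.
Variables (R : realType) (q : R) (k M L : nat) (T : eqType) (nb : T -> seq T).

(** [T] is only an [eqType]: the same definitions serve for the graph itself and for the graph on
    identifiers that a vertex reconstructs. *)
Definition covers (S : pred T) u := S u || has S (nb u).

Definition hard v : bool :=
  ~~ `[< exists s : seq T, [/\ size s <= k, v \notin s & all (covers (mem s)) (nb v)] >].

Definition open1 u := ~~ covers hard u.

Definition partners v : seq T :=
  [seq a <- undup (flatten [seq nb u | u <- nb v]) |
    (a != v) && (M <= count (fun u => open1 u && (a \in nb u)) (nb v))].

Definition pair_ends (e : T * T) := [:: e.1; e.2].
(** A vertex cover instance with pairs as elements. A pair occurs in both orders; the set of [v]
    holds the order starting with [v], and by symmetry both orders have the same level. *)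
Definition pair_elems v := [seq (v, a) | a <- partners v].
Definition pair_level := level q 1 L pair_ends pair_elems.
Definition paired := tight q 1 L pair_elems (pair_level L).

Definition open2 u := ~~ covers (fun v => hard v || paired v) u.

(* 7 = 2 * 3 + 1, where 3 bounds the number of edges per vertex. *)
Definition scale : R := (7 * q)^-1.
Definition star u := u :: nb u.
Definition star_elems v := [seq u <- star v | open2 u].
Definition star_level := level q scale L star star_elems.
Definition central := tight q scale L star_elems (star_level L).

(** The last alternative lets a vertex that nothing else dominates select itself; its dual value has
    then reached [scale], which pays for it. *)
Definition selected v := [|| hard v, paired v, central v | open2 v && ~~ covers central v].

End Algorithm.

(** * Counting dominators and exceptions *)

Section Analysis.
Local Open Scope nat_scope.
Variables (V : finType) (E : rel V) (nb : V -> seq V).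
Hypotheses (symE : symmetric E) (irrE : irreflexive E).
Hypothesis nbP : port_numbering E nb.
Hypothesis arcsP : forall A F b, minor_model E A F b -> symmetric F -> irreflexive F ->
  #|arcs A F| <= 6 * #|A|.
Hypothesis noK33 : forall s : seq V, size s = 6 -> uniq s ->
  (forall x y, x \in take 3 s -> y \in drop 3 s -> E x y) -> False.

Lemma mem_nb u v : (u \in nb v) = E v u.
Proof. by have [_ ->] := nbP v. Qed.

Lemma nb_uniq v : uniq (nb v).
Proof. by have [] := nbP v. Qed.

Lemma coversP (S : pred V) u :
  reflect (S u \/ exists2 v, E u v & S v) (covers nb S u).
Proof.
apply: (iffP orP) => -[Su|h]; [by left| |by left|]; right.
  by case/hasP: h => v; rewrite mem_nb => uv Sv; exists v.
by case: h => v uv Sv; apply/hasP; exists v; rewrite ?mem_nb.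
Qed.

Lemma arcs_le A : #|arcs A E| <= 6 * #|A|.
Proof.
apply: (@arcsP A E (fun x => [set x])) => //; split.
- by move=> x _; apply/set0Pn; exists x; rewrite inE.
- by move=> x _ u w /set1P-> /set1P->; apply: connect0.
- by move=> x y _ _ xy; rewrite disjoints1 inE.
by move=> x y _ _ xy; exists x, y; rewrite !inE.
Qed.

Definition links (S W : {set V}) : {set V * V} :=
  [set p | [&& p.1 \in S, p.2 \in W & E p.1 p.2]].

Lemma linksC S W : #|links S W| = #|links W S|.
Proof.
have inj : injective (fun p : V * V => (p.2, p.1)) by move=> [a b] [c d] [-> ->].
rewrite -(card_imset _ inj); apply: eq_card => -[x y].
apply/imsetP/idP => [[[a b] + [-> ->]]|].
  by rewrite !inE /= symE => /and3P[-> -> ->].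
by rewrite !inE /= => /and3P[xW yS xy]; exists (y, x); rewrite // !inE /= yS xW symE.
Qed.

(** [S] and [W] may overlap: links in both directions are arcs of the union, and those counted twice
    are arcs of the intersection. *)
Lemma links_le S W : #|links S W| <= 3 * #|S| + 3 * #|W|.
Proof.
suff : #|links S W| + #|links W S| <= #|arcs (S :|: W) E| + #|arcs (S :&: W) E|.
  have := arcs_le (S :|: W); have := arcs_le (S :&: W); have := cardsUI S W.
  by rewrite (linksC W S); lia.
rewrite -cardsUI; apply: leq_add; apply/subset_leq_card/subsetP => -[x y];
  rewrite !inE /=.
  by case/orP=> /and3P[-> -> ->]; rewrite ?orbT.
by case/andP=> /and3P[-> -> ->] /and3P[-> -> _].
Qed.

Lemma common_nbrs_le2 x y z (W : {set V}) : uniq [:: x; y; z] ->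
  {in W, forall u, [&& E x u, E y u & E z u]} -> #|W| <= 2.
Proof.
move=> xyz hW; rewrite leqNgt; apply/negP => W3.
have sz : size (take 3 (enum W)) = 3 by rewrite size_takel // -cardE.
have hs u : u \in take 3 (enum W) -> [&& E x u, E y u & E z u].
  by move/mem_take; rewrite mem_enum; apply: hW.
apply: (@noK33 ([:: x; y; z] ++ take 3 (enum W))); first by rewrite size_cat sz.
  rewrite cat_uniq xyz take_uniq ?enum_uniq // andbT; apply/hasPn => u /hs.
  by rewrite !inE => /and3P[xu yu zu]; apply/negP => /or3P[] /eqP e;
    move: xu yu zu; rewrite e irrE.
move=> a u; rewrite take_size_cat // drop_size_cat // !inE => + /hs /and3P[xu yu zu].
by case/or3P=> /eqP->.
Qed.

Lemma card_bigcup_le m (W A : {set V}) (U : V -> {set V}) : W \subset \bigcup_(z in A) U z ->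
  {in A, forall z, #|U z| <= m} -> #|W| <= #|A| * m.
Proof.
move=> sW Um; apply: leq_trans (subset_leq_card sW) _.
apply: (@leq_trans (\sum_(z in A) #|U z|)).
  elim/big_rec2: _ => [|z n S _ le_n]; first by rewrite cards0.
  by apply: leq_trans (leq_card_setU _ _) _; rewrite leq_add2l.
by rewrite -sum_nat_const; apply: leq_sum => z; apply: Um.
Qed.

(** A vertex [z] of [A] dominates at most three vertices of [W]: itself and, without [K_{3,3}], two
    common neighbors of [x], [y] and [z]. *)
Lemma dominators_ge x y (W A : {set V}) : x != y -> x \notin A -> y \notin A ->
    {in W, forall u, E x u /\ E y u} ->
    {in W, forall u, u \in A \/ exists2 z, E u z & z \in A} ->
  #|W| <= 3 * #|A|.
Proof.
move=> xy xA yA hW domW.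
have sW : W \subset \bigcup_(z in A) (W :&: (z |: [set u | E z u])).
  apply/subsetP => u uW; apply/bigcupP; case: (domW u uW) => [uA|[z uz zA]].
    by exists u; rewrite // !inE uW eqxx.
  by exists z; rewrite // !inE uW symE uz orbT.
rewrite mulnC; apply: card_bigcup_le sW _ => z zA; rewrite setIUr.
apply: leq_trans (leq_card_setU _ _) _.
apply: (@leq_add _ _ 1 2); first by rewrite (leq_trans (subset_leq_card (subsetIr _ _))) ?cards1.
apply: (@common_nbrs_le2 x y z) => [|u].
  have xz : x != z by apply: contraNneq xA => ->.
  have yz : y != z by apply: contraNneq yA => ->.
  by rewrite /= !inE negb_or xy xz yz.
by rewrite !inE => /andP[/hW[-> ->] ->].
Qed.

Lemma hard_dominators k v (A : {set V}) : hard k nb v -> v \notin A ->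
  (forall u, E v u -> u \in A \/ exists2 z, E u z & z \in A) -> k < #|A|.
Proof.
move=> hv vA domA; rewrite ltnNge; apply: contra hv => Ak; apply/asboolP.
exists (enum A); rewrite -cardE mem_enum; split=> //; apply/allP => u.
rewrite mem_nb => /domA h; apply/coversP; case: h => [uA|[z uz zA]]; [left|right].
  by rewrite /= mem_enum.
by exists z; rewrite //= mem_enum.
Qed.

Lemma not_hard_dominators k v : ~~ hard k nb v -> exists A : {set V},
  [/\ #|A| <= k, v \notin A &
    forall u, E v u -> u \in A \/ exists2 z, E u z & z \in A].
Proof.
rewrite negbK => /asboolP[s [sk vs /allP doms]]; exists [set x in s]; split.
- by rewrite (leq_trans _ sk) // cardsE card_size.
- by rewrite inE.
move=> u vu; have /doms/coversP[us|[z uz zs]] : u \in nb v by rewrite mem_nb.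
  by left; rewrite inE.
by right; exists z; rewrite // inE.
Qed.

Definition shared k v a : {set V} := [set u | [&& E v u, E a u & open1 k nb u]].

Lemma partnersE k M v a : 0 < M ->
  (a \in partners k M nb v) = (a != v) && (M <= #|shared k v a|).
Proof.
move=> M0.
have -> : #|shared k v a| = count (fun u => open1 k nb u && (a \in nb u)) (nb v).
  rewrite -size_filter -(card_uniqP _) ?filter_uniq ?nb_uniq //; apply: eq_card => u.
  by rewrite inE mem_filter !mem_nb (symE a) andbC [open1 _ _ _ && _]andbC.
rewrite mem_filter; case: (a != v) => //=; case: leqP => //= Mc; rewrite ?andbT ?andbF //.
have : 0 < count (fun u => open1 k nb u && (a \in nb u)) (nb v) by apply: leq_trans Mc.
rewrite -has_count => /hasP[u uv /andP[_ au]].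
by rewrite mem_undup; apply/flattenP; exists (nb u) => //; apply: map_f.
Qed.

Lemma partnersC k M v a : 0 < M -> (a \in partners k M nb v) = (v \in partners k M nb a).
Proof.
move=> M0; rewrite !partnersE // eq_sym; congr (_ && (_ <= _)).
by apply: eq_card => u; rewrite !inE andbCA.
Qed.

Lemma partners_not_hard k M v a : 0 < M -> a \in partners k M nb v -> ~~ hard k nb v.
Proof.
move=> M0; rewrite partnersE // => /andP[_ /(leq_trans M0)]; rewrite card_gt0 => /set0Pn[u].
rewrite inE => /and3P[vu _]; apply: contra => hv; apply/coversP; right.
by exists v; rewrite // symE.
Qed.

Lemma partners_uniq k M v : uniq (partners k M nb v).
Proof. by rewrite filter_uniq // undup_uniq. Qed.

(** A vertex [v] with a partner is not hard, so a set [A] of at most [k] vertices dominates its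
    neighbors. A partner outside [A] would share at most [3 * k] open vertices with [v], so all
    partners lie in [A]. *)
Lemma partners_size k v : size (partners k (3 * k).+1 nb v) <= k.
Proof.
case def_p: {1}(partners _ _ _ _) => [//|a p].
have ap : a \in partners k (3 * k).+1 nb v by rewrite def_p mem_head.
have [A [Ak vA domA]] := not_hard_dominators (partners_not_hard (ltn0Sn _) ap).
apply: leq_trans (Ak); rewrite cardE -def_p; apply: uniq_leq_size; first exact: partners_uniq.
move=> {a p def_p ap} a; rewrite partnersE // mem_enum => /andP[av shared_a].
apply: contraTT shared_a => aA; rewrite -leqNgt.
apply: (@leq_trans (3 * #|A|)); last by rewrite leq_mul2l.
apply: (@dominators_ge v a) => //; first by rewrite eq_sym.
  by move=> u; rewrite inE => /and3P[].
by move=> u; rewrite inE => /and3P[/domA].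
Qed.

(* Contract the fibers of [g]: the stars centered at [D] and the single vertices
   of [B]. *)
Lemma star_minor_bound (D B : {set V}) (g : V -> V) K : [disjoint B & D] ->
    {in D :|: B, forall u, g u = u} ->
    (forall u, u \notin D :|: B -> g u \in D /\ E u (g u)) ->
    {in B, forall v, K <= #|[set g u | u in E v]|} ->
  K * #|B| <= 6 * (#|D| + #|B|).
Proof.
move=> BD gid gout gK.
pose b x := [set u | g u == x].
pose F : rel V := [rel x y | (x != y) &&
  [exists p : V * V, [&& g p.1 == x, g p.2 == y & E p.1 p.2]]].
have symF : symmetric F.
  move=> x y; rewrite /F /= eq_sym; congr (_ && _).
  apply/existsP/existsP => -[[u w] /= /and3P[ux wy uw]];
  by exists (w, u); rewrite /= ux wy symE.
have irrF : irreflexive F by move=> x; rewrite /F /= eqxx.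
have gA u : g u \in D :|: B.
  have [uA|/gout[gD _]] := boolP (u \in D :|: B); first by rewrite gid.
  by rewrite inE gD.
have model : minor_model E (D :|: B) F b.
  have to_center x u : x \in D :|: B -> g u = x ->
      connect (inside E (b x)) u x && connect (inside E (b x)) x u.
    move=> xA ux; have [uA|/gout[_]] := boolP (u \in D :|: B).
      by rewrite -ux gid // connect0.
    by rewrite ux => uEx; rewrite !connect1 // /inside /= ?(symE x) uEx !inE ?ux gid // eqxx.
  split.
  - by move=> x xA; apply/set0Pn; exists x; rewrite inE gid.
  - move=> x xA u w; rewrite !inE => /eqP ux /eqP wx.
    have /andP[ux1 _] := to_center x u xA ux; have /andP[_ wx2] := to_center x w xA wx.
    exact: connect_trans ux1 wx2.
  - move=> x y _ _ xy; rewrite -setI_eq0; apply/eqP/setP => u; rewrite !inE.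
    by apply: contraNF xy => /andP[/eqP<- /eqP<-].
  move=> x y _ _ /andP[_ /existsP[[u w] /and3P[/= ux wy uw]]].
  by exists u, w; rewrite !inE.
have := arcsP model symF irrF.
have -> : #|D :|: B| = #|D| + #|B|.
  by rewrite cardsU setIC (eqP (_ : B :&: D == set0)) ?setI_eq0 // cards0 subn0.
apply: leq_trans; rewrite -sum_nbrs mulnC -sum_nat_const.
apply: (@leq_trans (\sum_(v in B) #|nbrs (D :|: B) F v|)); last first.
  rewrite [leqRHS](big_setID B) /=.
  have -> : (D :|: B) :&: B = B.
    by apply/setP => u; rewrite !inE; case: (u \in B); rewrite ?orbT ?andbF.
  exact: leq_addr.
apply: leq_sum => v vB; apply: leq_trans (gK v vB) (subset_leq_card _).
apply/subsetP => _ /imsetP[u vu ->]; rewrite inE gA /F /=.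
have gv : g v = v by rewrite gid // inE vB orbT.
apply/andP; split; last by apply/existsP; exists (v, u); rewrite /= gv !eqxx.
have [uA|/gout[gD _]] := boolP (u \in D :|: B).
  by rewrite gid //; apply: contraTneq vu => ->; rewrite unfold_in irrE.
by apply: contraTneq gD => <-; rewrite (disjointFr BD).
Qed.

(** [B] collects the exceptions outside [D]. The images under [g] of the neighbors of an exception
    dominate these neighbors, so hardness, or [3 * k + 1] shared vertices, forces more than [k]
    images. *)
Lemma exceptional_set k (D : {set V}) : dominating E D -> exists B : {set V},
  [/\ k.+1 * #|B| <= 6 * (#|D| + #|B|),
      forall v, hard k nb v -> v \in D :|: B &
      forall v a, a \in partners k (3 * k).+1 nb v -> (v \in D :|: B) || (a \in D :|: B)].
Proof.
move=> /forallP domD; set M := (3 * k).+1.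
pose bad v := [exists a, (a \notin D) && (a \in partners k M nb v)].
pose B := [set v in ~: D | hard k nb v || bad v].
(* Outside [D :|: B] the [pick] succeeds because [D] is dominating. *)
pose g u := if u \in D :|: B then u else odflt u [pick z in D | E u z].
have gid : {in D :|: B, forall u, g u = u} by move=> u uA; rewrite /g uA.
have gout u : u \notin D :|: B -> g u \in D /\ E u (g u).
  move=> uA; rewrite /g (negPf uA); case: pickP => [z /andP[]//|none].
  move: uA (domD u); rewrite inE negb_or => /andP[/negPf-> _] /= /exists_inP[z zD uz].
  by have := none z; rewrite zD uz.
have g_neq u x : E x u -> x \notin D -> g u != x.
  move=> xu xD; have [uA|/gout[gD _]] := boolP (u \in D :|: B).
    by rewrite gid //; apply: contraTneq xu => ->; rewrite irrE.
  by apply: contraNneq xD => <-.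
have g_dom u (S : {set V}) : g u \in S -> u \in S \/ exists2 z, E u z & z \in S.
  have [uA|/gout[_ uE]] := boolP (u \in D :|: B); first by rewrite gid //; left.
  by move=> gS; right; exists (g u).
exists B; split.
- apply: (star_minor_bound (g := g)) => //.
    rewrite -setI_eq0; apply/eqP/setP => u; rewrite !inE.
    by case: (u \in D); rewrite ?andbF.
  move=> v; rewrite !inE => /andP[vD /orP[hv|/existsP[a /andP[aD]]]].
    apply: hard_dominators hv _ _ => [|u vu].
      by apply/imsetP => -[u vu /eqP]; rewrite eq_sym; apply/negP/g_neq.
    by apply: g_dom; apply: imset_f.
  rewrite partnersE // => /andP[av]; set W := shared _ _ _ => W_big.
  have W3 : #|W| <= 3 * #|[set g u | u in W]|.
    apply: (@dominators_ge v a); first by rewrite eq_sym.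
    - by apply/imsetP => -[u]; rewrite inE => /and3P[vu _ _] /eqP; rewrite eq_sym; apply/negP/g_neq.
    - by apply/imsetP => -[u]; rewrite inE => /and3P[_ au _] /eqP; rewrite eq_sym; apply/negP/g_neq.
    - by move=> u; rewrite inE => /and3P[].
    by move=> u uW; apply: g_dom; apply: imset_f.
  apply: (@leq_trans #|[set g u | u in W]|); first by move: W_big; rewrite /M; lia.
  apply/subset_leq_card/imsetS/subsetP => u; rewrite inE => /and3P[vu _ _].
  by rewrite unfold_in.
- by move=> v hv; rewrite !inE hv; case: (v \in D).
move=> v a av; rewrite !inE; case vD: (v \in D) => //=; case aD: (a \in D); rewrite ?orbT //=.
by apply/orP; left; apply/orP; right; apply/existsP; exists a; rewrite aD.
Qed.

(** * Links weighted by dual values *)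

Section WeightedLinks.
Local Open Scope ring_scope.
Variable R : realType.

(* Apply [links_le] to the level sets [l >= j] and sum over [j] with weights
   [delta j]. *)
Lemma links_weighted (S W : {set V}) (n : nat) (delta : nat -> R) (l : V -> nat) (x : V -> R) :
    (forall j, 0 <= delta j) ->
    {in W, forall u, x u = \sum_(j < n) delta j * (j <= l u)%N%:R} ->
  \sum_(v in S) \sum_(u in W | E v u) x u <=
  3 * (\sum_(j < n) delta j) * #|S|%:R + 3 * \sum_(u in W) x u.
Proof.
move=> delta_ge0 xE; pose Wj j := [set u in W | (j <= l u)%N].
have -> : \sum_(v in S) \sum_(u in W | E v u) x u =
    \sum_(j < n) delta j * #|links S (Wj j)|%:R.
  transitivity (\sum_(v in S) \sum_(j < n) \sum_(u in W | E v u) delta j * (j <= l u)%N%:R).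
    apply: eq_bigr => v _; rewrite exchange_big /=; apply: eq_bigr => u /andP[uW _].
    exact: xE.
  rewrite exchange_big /=; apply: eq_bigr => j _.
  under eq_bigr do rewrite -mulr_sumr.
  rewrite -mulr_sumr; congr (_ * _); rewrite -sum1_card natr_sum.
  rewrite (eq_bigl (fun p : V * V => (p.1 \in S) && ((p.2 \in Wj j) && E p.1 p.2))); last first.
    by move=> p; rewrite inE.
  rewrite -(pair_big_dep (mem S) (fun v u => (u \in Wj j) && E v u) (fun _ _ => 1)) /=.
  apply: eq_bigr => v _; rewrite big_mkcond [RHS]big_mkcond /=; apply: eq_bigr => u _.
  by rewrite inE; case: (u \in W); case: (E v u); case: (j <= l u)%N.
have -> : \sum_(u in W) x u = \sum_(j < n) delta j * #|Wj j|%:R.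
  rewrite (eq_bigr _ xE) exchange_big /=; apply: eq_bigr => j _; rewrite -mulr_sumr.
  congr (_ * _); rewrite -sum1_card natr_sum big_mkcond [RHS]big_mkcond /=.
  by apply: eq_bigr => u _; rewrite inE; case: (u \in W); case: (j <= l u)%N.
rewrite mulr_sumr mulr_suml [X in _ + X]mulr_sumr -big_split /=; apply: ler_sum => j _.
rewrite -mulrA mulrCA [X in _ + X]mulrCA -mulrDr ler_wpM2l //.
by rewrite -!natrM -natrD ler_nat links_le.
Qed.

(** [G l] is the sum of its increments up to [l]; this is the form of weight that [links_weighted]
    takes. *)
Lemma telescope_indicator (G : nat -> R) n l : (l < n)%N ->
  \sum_(j < n) (if (j : nat) is j'.+1 then G j - G j' else G 0%N) * (j <= l)%N%:R = G l.
Proof.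
move=> ln; rewrite -(big_mkord xpredT
  (fun j => (if j is j'.+1 then G j - G j' else G 0%N) * (j <= l)%N%:R)).
rewrite (big_cat_nat (n := l.+1)) //= [X in _ + X]big_nat_cond [X in _ + X]big1 ?addr0; last first.
  by move=> j; rewrite andbT => /andP[lj _]; rewrite leqNgt lj mulr0.
elim: l {ln} => [|l IHl]; first by rewrite big_nat1 mulr1.
rewrite big_nat_recr //= leqnn mulr1 -[X in X + _](_ : G l = _) ?subrKC //.
rewrite -IHl big_nat_cond [RHS]big_nat_cond; apply: eq_bigr => j.
by rewrite andbT => /andP[_ jl]; rewrite ltnS in jl; rewrite jl leqW.
Qed.
End WeightedLinks.

(** * Size of the selected set *)

Section Selection.
Variables (R : realType) (q : R) (k L : nat).
Let M := (3 * k).+1.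
Hypotheses (q_gt1 : (1 < q)%R)
  (leL : ((k * M + 1)%N%:R <= q ^+ L)%R).
Local Notation paired := (paired q k M L nb).
Local Notation open2 := (open2 q k M L nb).
Local Notation partners := (partners k M nb).
Local Notation pair_level := (pair_level q k M L nb).

Let q_gt0 : (0 < q)%R.
Proof. exact: lt_trans q_gt1. Qed.

Lemma pair_load_le1 v : (load q 1 L (pair_elems k M nb) (pair_level L) v <= 1)%R.
Proof.
apply: load_le1 => // [{}v i /mapP[a _ ->]|{}v]; first exact: mem_head.
rewrite mul1r size_map; apply: le_trans leL; rewrite ler_nat.
apply: leq_trans (partners_size k v) _; rewrite /M; nia.
Qed.

(** If neither end were paired, the pair would have been raised at every step up to the value 1,
    which alone makes [v] tight. *)
Lemma pair_covered v a : a \in partners v -> paired v || paired a.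
Proof.
move=> av; apply: contraT => h.
have lev : pair_level L (v, a) = L by apply: level_untight; rewrite //= orbF.
have val1 : value q 1 L (pair_level L) (v, a) = 1%R.
  by rewrite /value lev mul1r divff // expf_neq0 // gt_eqF.
suff pv : paired v by rewrite pv in h.
apply: (@le_trans _ _ 1%R); first by rewrite invf_le1 // ltW.
rewrite /load (big_rem (v, a)) /=; last exact: map_f.
rewrite val1 lerDl; apply: sumr_ge0 => i _; exact: value_ge0.
Qed.

Lemma open2_open1 u : open2 u -> open1 k nb u.
Proof.
by apply: contra => /coversP[hu|[v uv hv]]; apply/coversP; [left|right; exists v];
  rewrite // ?hu ?hv.
Qed.

Lemma open2_nbr u v : open2 u -> E u v || (u == v) -> ~~ (hard k nb v || paired v).
Proof.
move=> ou uv; apply: contra ou => hv; apply/coversP; case/orP: uv => [uv|/eqP->]; last by left.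
by right; exists v.
Qed.

(** If an open vertex is [v] or adjacent to it, then [v] is neither hard nor paired, and [k]
    vertices dominate its neighbors. Each dominates at most [1 + 3 * k] open neighbors of [v]:
    beyond that it would be a partner of [v], hence paired, and could have no open neighbor. The
    final 1 counts [v] itself. *)
Lemma star_elems_size v : size (star_elems q k M L nb v) <= k * M + 1.
Proof.
have [/hasP[w]|/hasPn none] := boolP (has open2 (star nb v)); last first.
  rewrite /star_elems; suff -> : [seq u <- star nb v | open2 u] = [::] by [].
  by apply/eqP; rewrite -[_ == _]negbK -has_filter; apply/hasPn.
rewrite inE mem_nb => wv ow.
have : ~~ (hard k nb v || paired v) by apply: open2_nbr ow _; rewrite symE orbC.
rewrite negb_or => /andP[nhv npv]; have [A [Ak vA domA]] := not_hard_dominators nhv.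
pose W := [set u | E v u && open2 u].
have -> : size (star_elems q k M L nb v) = open2 v + #|W|.
  rewrite /star_elems /star /=; suff -> : #|W| = size [seq u <- nb v | open2 u].
    by case: ifP; rewrite ?add1n.
  rewrite -(card_uniqP _) ?filter_uniq ?nb_uniq //; apply: eq_card => u.
  by rewrite inE mem_filter mem_nb andbC.
rewrite addnC leq_add ?leq_b1 //; apply: (@leq_trans (#|A| * M)); last by rewrite leq_mul2r Ak orbT.
apply: (@card_bigcup_le _ _ _ (fun z => W :&: (z |: [set u | E z u]))) => [|z zA].
  apply/subsetP => u uW; have := uW; rewrite inE => /andP[/domA dom_u _].
  apply/bigcupP; case: dom_u => [uA|[z uz zA]].
    by exists u; rewrite // !inE in uW *; rewrite uW eqxx.
  by exists z; rewrite // in_setI uW !inE symE uz orbT.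
rewrite setIUr; apply: leq_trans (leq_card_setU _ _) _.
apply: (@leq_add _ _ 1 (3 * k)).
  by rewrite (leq_trans (subset_leq_card (subsetIr _ _))) ?cards1.
rewrite leqNgt; apply/negP => big.
have zv : z \in partners v.
  rewrite partnersE // /M; apply/andP; split; first by apply: contraNneq vA => <-.
  apply: leq_trans big (subset_leq_card _); apply/subsetP => u; rewrite !inE.
  by case/andP=> /andP[-> /open2_open1->] ->.
have pz : paired z by have := pair_covered zv; rewrite (negPf npv).
have /set0Pn[u] : W :&: [set u | E z u] != set0 by rewrite -card_gt0; apply: leq_trans big.
rewrite !inE => /andP[/andP[_ ou] zu].
have : ~~ (hard k nb z || paired z) by apply: open2_nbr ou _; rewrite symE zu.
by rewrite pz orbT.
Qed.

Local Open Scope ring_scope.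

Lemma pair_levelC t v a : pair_level t (v, a) = pair_level t (a, v).
Proof. by elim: t => //= t ->; rewrite !orbF orbC. Qed.

Lemma pair_load v : load q 1 L (pair_elems k M nb) (pair_level L) v =
  \sum_(a | a \in partners v) value q 1 L (pair_level L) (v, a).
Proof. by rewrite /load big_map big_uniq ?partners_uniq. Qed.

Lemma tight_card (c : R) (T : eqType) (elems : V -> seq T) (l : T -> nat) (S : {set V}) :
  {in S, forall v, tight q c L elems l v} ->
  #|S|%:R <= q * \sum_(v in S) load q c L elems l v.
Proof.
move=> tS; rewrite mulr_sumr -sum1_card natr_sum; apply: ler_sum => v vS.
by rewrite -(ler_pM2l (x := q^-1)) ?invr_gt0 // mulr1 mulKf ?gt_eqF //; apply: tS.
Qed.

(** Paired vertices are paid by the values of their pairs, each of which has an end in [X] or [Z]. A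
    vertex of [X] is charged both as paired vertex and as partner, a vertex of [Z] only as
    partner. *)
Lemma paired_bound (X Z : {set V}) :
    (forall v a, a \in partners v -> (v \in X :|: Z) || (a \in X :|: Z)) ->
    {in Z, forall v, ~~ paired v} ->
  #|[set v | paired v]|%:R <= q * (2 * #|X|%:R + #|Z|%:R).
Proof.
move=> coverXZ Zfree; set S := [set v | paired v].
apply: (@le_trans _ _ (q * \sum_(v in S) load q 1 L (pair_elems k M nb) (pair_level L) v)).
  by apply: tight_card => v; rewrite inE.
rewrite ler_pM2l //.
pose y v a := value q 1 L (pair_level L) (v, a).
have y_ge0 v a : 0 <= y v a by apply: value_ge0.
pose m a : R := (a \in X)%:R + (a \in Z)%:R.
apply: (@le_trans _ _ (\sum_v \sum_(a | a \in partners v) (y v a * (v \in X)%:R + y v a * m a))).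
  rewrite big_mkcond /=; apply: ler_sum => v _; rewrite inE pair_load.
  have [pv|_] := boolP (paired v); last first.
    by apply: sumr_ge0 => a _; rewrite addr_ge0 // mulr_ge0 // ?addr_ge0.
  apply: ler_sum => a av; rewrite -mulrDr -[leLHS]mulr1 ler_wpM2l ?value_ge0 //.
  have vZ : v \notin Z by apply: contraL pv; apply: Zfree.
  have := coverXZ v a av; rewrite !inE (negPf vZ) orbF /m.
  by case: (v \in X); case: (a \in X); case: (a \in Z) => /= h; lra.
under eq_bigr do rewrite big_split /=.
rewrite big_split /= mulr_natl mulr2n -addrA; apply: lerD.
  rewrite -sum1_card natr_sum [leRHS]big_mkcond /=; apply: ler_sum => v _.
  rewrite -mulr_suml -pair_load; case: (v \in X); rewrite ?mulr0 // mulr1.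
  exact: pair_load_le1.
rewrite (exchange_big_dep xpredT) //=.
have -> : #|X|%:R + #|Z|%:R = \sum_a m a.
  rewrite big_split /= -!sum1_card !natr_sum [X in X + _]big_mkcond [X in _ + X]big_mkcond /=.
  by congr (_ + _); apply: eq_bigr => a _; case: (_ \in _).
apply: ler_sum => a _; rewrite -mulr_suml -[leRHS]mul1r ler_wpM2r ?addr_ge0 //.
apply: le_trans (pair_load_le1 a); rewrite pair_load le_eqVlt; apply/orP; left; apply/eqP.
apply: eq_big => v; first exact: partnersC.
by move=> _; rewrite /y /value pair_levelC.
Qed.


Local Notation scale := (scale q).
Local Notation star_level := (star_level q k M L nb).
Local Notation central := (central q k M L nb).
Local Notation x := (value q scale L (star_level L)).

Let scale_gt0 : 0 < scale.
Proof. by rewrite invr_gt0 mulr_gt0. Qed.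

Lemma star_load v : load q scale L (star_elems q k M L nb) (star_level L) v =
  \sum_(u | open2 u && ((u == v) || E v u)) x u.
Proof.
rewrite /load big_uniq; last by rewrite filter_uniq //= nb_uniq mem_nb irrE.
by apply: eq_bigl => u; rewrite mem_filter inE mem_nb.
Qed.

Lemma star_load_le1 v : load q scale L (star_elems q k M L nb) (star_level L) v <= 1.
Proof.
apply: load_le1 => [//||{}v i|{}v]; first exact: ltW.
  by rewrite mem_filter !inE !mem_nb symE eq_sym => /andP[].
apply: le_trans leL; rewrite -[leRHS]mul1r ler_pM ?ler_nat ?star_elems_size //; first exact: ltW.
by rewrite invf_le1 ?mulr_gt0 //; have := q_gt1; lra.
Qed.

Lemma star_value_le u : x u <= scale.
Proof.
rewrite ler_pdivrMr ?exprn_gt0 // ler_pM2l //; apply: ler_weXn2l; first exact: ltW.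
exact: level_le.
Qed.

(** A central vertex is paid by its own value, at most [scale], and by its links to [W]. With [w]
    the total value of [W], [links_weighted] gives [#|S| <= 4 * q * scale * #|S| + 3 * q * w], that
    is [#|S| <= 7 * q * w]. Vertices of [U] have value [scale] each, and as [Z] dominates all open
    vertices, the values sum to at most [#|Z|]. *)
Lemma central_bound (Z : {set V}) :
    (forall u, open2 u -> u \in Z \/ exists2 z, E u z & z \in Z) ->
  (#|[set v | central v]| + #|[set u | open2 u && ~~ covers nb central u]|)%N%:R
    <= 7 * q * #|Z|%:R.
Proof.
move=> domZ; set S := [set v | _]; set U := [set u | _].
pose W := [set u | open2 u && covers nb central u].
have x_ge0 u : 0 <= x u by apply: value_ge0 => //; apply: ltW.
have XU : scale * #|U|%:R = \sum_(u in U) x u.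
  rewrite -sum1_card natr_sum mulr_sumr; apply: eq_bigr => u; rewrite inE => /andP[_ nu].
  have lev : star_level L u = L by apply: level_untight => //; apply: ltW.
  by rewrite mulr1 /value lev mulfK ?expf_neq0 ?gt_eqF.
have XS : #|S|%:R <= q * (scale * #|S|%:R + \sum_(v in S) \sum_(u in W | E v u) x u).
  have tS : {in S, forall v, tight q scale L (star_elems q k M L nb) (star_level L) v}.
    by move=> v; rewrite inE.
  apply: le_trans (tight_card tS) _.
  rewrite ler_pM2l // -sum1_card natr_sum mulr_sumr -big_split /=; apply: ler_sum => v.
  rewrite inE => cv; rewrite star_load mulr1 (bigID (pred1 v)) /=; apply: lerD.
    rewrite big_mkcond (bigD1 v) //= big1 ?addr0; last first.
      by move=> u uv; rewrite (negPf uv) andbF.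
    by case: ifP => _; rewrite ?star_value_le // ltW.
  rewrite le_eqVlt; apply/orP; left; apply/eqP; apply: eq_bigl => u.
  rewrite !inE; case: eqVneq => [->|uv] /=; first by rewrite irrE !andbF.
  rewrite andbT; case: (open2 u) => //=; case vu: (E v u); rewrite ?andbF //= andbT.
  by apply/esym/coversP; right; exists v; rewrite // symE.
(* [G j] is the value of an element of level [j]; its increments [delta] sum to [G L], which is
   [scale]. *)
pose G j : R := scale * q ^+ j / q ^+ L.
pose delta j : R := if j is j'.+1 then G j - G j' else G 0%N.
have delta_ge0 j : 0 <= delta j.
  have G_ge0 i : 0 <= G i by rewrite divr_ge0 ?mulr_ge0 ?exprn_ge0 // ltW.
  case: j => [|j] //=; rewrite subr_ge0 ler_pM2r ?invr_gt0 ?exprn_gt0 //.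
  by rewrite ler_pM2l // ler_weXn2l // ltW.
have := @links_weighted R S W L.+1 delta (star_level L) x delta_ge0.
have -> : \sum_(j < L.+1) delta j = scale.
  have <- : G L = scale by rewrite /G mulfK // expf_neq0 // gt_eqF.
  rewrite -(telescope_indicator G (ltnSn L)); apply: eq_bigr => j _.
  by rewrite -ltnS ltn_ord mulr1.
move=> XW; have lev_lt u : (star_level L u < L.+1)%N by rewrite ltnS; apply: level_le.
have {}XW := XW (fun u _ => esym (telescope_indicator G (lev_lt u))).
have XZ : \sum_(u in W) x u + \sum_(u in U) x u <= #|Z|%:R.
  rewrite -sum1_card natr_sum.
  apply: (@le_trans _ _ (\sum_(z in Z) \sum_(u | open2 u && ((u == z) || E z u)) x u)); last first.
    by apply: ler_sum => z _; rewrite -star_load; apply: star_load_le1.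
  rewrite (exchange_big_dep xpredT) //= [X in X + _]big_mkcond [X in _ + X]big_mkcond -big_split /=.
  apply: ler_sum => u _; rewrite !inE.
  case ou: (open2 u); last by rewrite addr0; apply: sumr_ge0.
  have [z zZ uz] : exists2 z, z \in Z & (u == z) || E z u.
    case: (domZ u ou) => [uZ|[z uz zZ]]; first by exists u; rewrite ?eqxx.
    by exists z; rewrite // symE uz orbT.
  rewrite (bigD1 z) ?zZ //=; apply: (@le_trans _ _ (x u)).
    by case: covers; rewrite ?addr0 ?add0r.
  by rewrite lerDl; apply: sumr_ge0.
have scaleE : 7 * q * scale = 1 by rewrite mulfV // gt_eqF // mulr_gt0.
have S_le : #|S|%:R <= 7 * q * \sum_(u in W) x u.
  have := le_trans XS (ler_wpM2l (ltW q_gt0) (lerD (lexx _) XW)).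
  move: (#|S|%:R) (\sum_(u in W) x u) => s w h.
  have : q * (scale * s + (3 * scale * s + 3 * w)) =
    4 / 7 * (7 * q * scale) * s + 3 * q * w by field.
  by rewrite scaleE => e; rewrite e in h; lra.
have U_le : #|U|%:R <= 7 * q * \sum_(u in U) x u.
  by rewrite -XU mulrA scaleE mul1r.
rewrite natrD; apply: le_trans (lerD S_le U_le) _; rewrite -mulrDr ler_wpM2l //.
by rewrite ltW // mulr_gt0.
Qed.

Local Notation selected := (selected q k M L nb).

Lemma selected_dominating : dominating E [set v | selected v].
Proof.
apply/forallP => v; have [ov|] := boolP (open2 v); last first.
  rewrite negbK => /coversP[|[u vu]] /orP hu; apply/orP; [left|right].
    by rewrite inE ; case: hu => hu; rewrite /selected hu ?orbT.
  by apply/exists_inP; exists u; rewrite // inE; case: hu => hu; rewrite /selected hu ?orbT.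
have [/coversP[cv|[u vu cu]]|nv] := boolP (covers nb central v); apply/orP.
- by left; rewrite inE /selected cv !orbT.
- by right; apply/exists_inP; exists u; rewrite // inE /selected cu !orbT.
by left; rewrite inE /selected ov nv !orbT.
Qed.

(** In [D :|: B], a hard or paired vertex pays 1 for the hard vertices and [2 * q] for the paired
    ones; any other vertex pays [q] for the paired ones and [7 * q] for the last phase. Both totals
    are at most [8 * q]. *)
Lemma selected_bound (D : {set V}) : 6 <= (q - 1) * (k%:R - 5) -> dominating E D ->
  #|[set v | selected v]|%:R <= 8 * q * q * #|D|%:R.
Proof.
move=> kq domD; have [B [cardB hardDB coverDB]] := exceptional_set k domD.
set Ds := D :|: B in hardDB coverDB.
pose S12 := [set v | hard k nb v || paired v].
pose X := Ds :&: S12; pose Z := Ds :\: S12.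
have XZ : X :|: Z = Ds by rewrite setID.
have hX : #|[set v | hard k nb v]|%:R <= #|X|%:R :> R.
  rewrite ler_nat; apply/subset_leq_card/subsetP => v; rewrite inE => hv.
  by rewrite in_setI (hardDB v hv) inE hv.
have pX : #|[set v | paired v]|%:R <= q * (2 * #|X|%:R + #|Z|%:R).
  apply: paired_bound => [v a /coverDB|v]; first by rewrite XZ.
  by rewrite in_setD inE negb_or => /andP[/andP[]].
have cZ : (#|[set v | central v]| + #|[set u | open2 u && ~~ covers nb central u]|)%N%:R
    <= 7 * q * #|Z|%:R.
  apply: central_bound => u ou.
  have inZ z : z \in D -> E u z || (u == z) -> z \in Z.
    by move=> zD uz; rewrite !inE zD (open2_nbr ou uz).
  have /orP[uD|/exists_inP[z zD uz]] := forallP domD u.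
    by left; apply: inZ; rewrite ?eqxx ?orbT.
  by right; exists z; rewrite ?inZ ?uz.
have cover_sel : [set v | selected v] \subset [set v | hard k nb v] :|: [set v | paired v] :|:
    ([set v | central v] :|: [set u | open2 u && ~~ covers nb central u]).
  by apply/subsetP => v; rewrite !inE /selected -!orbA.
have cardXZ : #|X|%:R + #|Z|%:R = #|Ds|%:R :> R by rewrite -natrD cardsID.
(* The bound on [B] and the choice of [k] give [#|B| <= (q - 1) * #|D|]. *)
have cardDs : #|Ds|%:R <= q * #|D|%:R.
  have : #|Ds|%:R <= #|D|%:R + #|B|%:R :> R by rewrite -natrD ler_nat leq_card_setU.
  move: cardB; rewrite -(ler_nat R) !natrM natrD -natr1.
  have := q_gt1; have : 0 <= #|B|%:R :> R by [].
  move: kq; move: (k%:R) (#|D|%:R) (#|B|%:R) (#|Ds|%:R) => k' d b s; nra.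
have : #|[set v | selected v]|%:R <= #|[set v | hard k nb v]|%:R + #|[set v | paired v]|%:R +
    (#|[set v | central v]| + #|[set u | open2 u && ~~ covers nb central u]|)%N%:R :> R.
  rewrite -!natrD ler_nat; apply: leq_trans (subset_leq_card cover_sel) _.
  apply: leq_trans (leq_card_setU _ _) (leq_add _ _); exact: leq_card_setU.
move/le_trans; apply; apply: le_trans (lerD (lerD hX pX) cZ) _.
apply: (@le_trans _ _ (8 * q * #|Ds|%:R)); last first.
  by rewrite -[leRHS]mulrA ler_wpM2l // mulr_ge0 // ltW.
rewrite -cardXZ; have := q_gt1; have : 0 <= #|X|%:R :> R by [].
move: (#|X|%:R) (#|Z|%:R) => a c a0 q1; nra.
Qed.
End Selection.
End Analysis.

(** * Locality *)

Section Locality.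
Local Open Scope nat_scope.
Variables (R : realType) (q : R) (k M L : nat).
Variables (T T' : eqType) (nb : T -> seq T) (nb' : T' -> seq T') (f : T -> T').
Hypothesis f_inj : injective f.

(* Up to [f], the two graphs coincide in the ball of radius [r] around [v]. *)
Fixpoint agree r v : Prop := nb' (f v) = [seq f u | u <- nb v] /\
  if r is r'.+1 then forall u, u \in nb v -> agree r' u else True.

Lemma agree_nb r v : agree r v -> nb' (f v) = [seq f u | u <- nb v].
Proof. by case: r => [|r] []. Qed.

Lemma agree_step r v u : agree r.+1 v -> u \in nb v -> agree r u.
Proof. by case=> _; apply. Qed.

Lemma agreeW r s v : s <= r -> agree r v -> agree s v.
Proof.
elim: r s v => [|r IHr] [|s] v //= sr [nbv nbr]; split=> // u /nbr; exact: IHr.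
Qed.

Lemma transfer_covers r (S : pred T) (S' : pred T') u :
    (forall v, agree r v -> S' (f v) = S v) -> agree r.+1 u ->
  covers nb' S' (f u) = covers nb S u.
Proof.
move=> SS au; rewrite /covers (agree_nb au) has_map (SS u (agreeW (leqnSn r) au)).
congr (_ || _); apply: eq_in_has => v uv /=; apply: SS; exact: agree_step au uv.
Qed.

(** A list over [T'] can be cut down to preimages among the neighbors of [v] and their neighbors,
    since no other vertex dominates a neighbor of [v]. *)
Lemma transfer_hard v : agree 1 v -> hard k nb' (f v) = hard k nb v.
Proof.
move=> av; congr (~~ _); apply/asboolP/asboolP => -[s [sk vs cov_s]].
  exists [seq x <- undup (flatten [seq u :: nb u | u <- nb v]) | f x \in s]; split.
  - apply: leq_trans sk; rewrite -(size_map f); apply: uniq_leq_size.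
      by rewrite map_inj_uniq // filter_uniq // undup_uniq.
    by move=> y /mapP[x]; rewrite mem_filter => /andP[fx _] ->.
  - by rewrite mem_filter negb_and vs.
  rewrite (agree_nb av) all_map in cov_s; apply/allP => u uv.
  have in_flat x : x \in u :: nb u -> x \in undup (flatten [seq u :: nb u | u <- nb v]).
    by move=> xu; rewrite mem_undup; apply/flattenP; exists (u :: nb u); rewrite // map_f.
  have /orP[us|] := allP cov_s u uv.
    by rewrite /covers /= mem_filter (us : f u \in s) in_flat // mem_head.
  rewrite (agree_nb (agree_step av uv)) has_map => /hasP[x xu xs].
  apply/orP; right; apply/hasP; exists x; rewrite //= mem_filter in_flat ?andbT //.
  by rewrite in_cons xu orbT.
exists (map f s); rewrite size_map mem_map //; split=> //.
rewrite (agree_nb av) all_map; apply/allP => u uv /=.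
rewrite /covers /= mem_map // (agree_nb (agree_step av uv)) has_map.
rewrite (eq_has (a2 := mem s)); first exact: (allP cov_s).
by move=> x /=; rewrite mem_map.
Qed.

Lemma transfer_open1 v : agree 2 v -> open1 k nb' (f v) = open1 k nb v.
Proof. by move=> av; congr (~~ _); apply: transfer_covers av; exact: transfer_hard. Qed.

Lemma transfer_partners v : agree 3 v ->
  partners k M nb' (f v) = [seq f a | a <- partners k M nb v].
Proof.
move=> av; rewrite /partners (agree_nb av) -map_comp.
rewrite (_ : map (nb' \o f) _ = map (map f) (map nb (nb v))); last first.
  rewrite -map_comp; apply/eq_in_map => u uv /=; exact: agree_nb (agree_step av uv).
rewrite -map_flatten undup_map_inj // filter_map; congr (map _ _).
apply: eq_filter => a /=; rewrite (inj_eq f_inj) count_map; congr (_ && (_ <= _)).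
apply: eq_in_count => u uv /=; have au := agree_step av uv.
by rewrite transfer_open1 // (agree_nb au) mem_map.
Qed.

Lemma agree_partner r v a : agree r.+2 v -> a \in partners k M nb v -> agree r a.
Proof.
rewrite mem_filter mem_undup => av /andP[_ /flattenP[_ /mapP[u uv ->] au]].
exact: agree_step (agree_step av uv) au.
Qed.

(** Each primal-dual step adds 2 to the radius, since partners are at most two edges apart. *)
Lemma transfer_pair_tight t v :
    (forall v a, agree (1 + 2 * t) v -> agree (1 + 2 * t) a ->
      pair_level q k M L nb' t (f v, f a) = pair_level q k M L nb t (v, a)) ->
    agree (3 + 2 * t) v ->
  tight q 1 L (pair_elems k M nb') (pair_level q k M L nb' t) (f v) =
  tight q 1 L (pair_elems k M nb) (pair_level q k M L nb t) v.
Proof.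
move=> lev av; have av3 : agree 3 v by apply: agreeW av; lia.
congr (_ <= _)%R; rewrite /load /pair_elems transfer_partners // -map_comp !big_map.
apply: eq_big_seq => a va; rewrite /value lev //; first by apply: agreeW av; lia.
by apply: agree_partner va; apply: agreeW av; lia.
Qed.

Lemma transfer_pair_level t v a : agree (1 + 2 * t) v -> agree (1 + 2 * t) a ->
  pair_level q k M L nb' t (f v, f a) = pair_level q k M L nb t (v, a).
Proof.
elim: t v a => // t IHt v a av aa.
have [av3 aa3] : agree (3 + 2 * t) v /\ agree (3 + 2 * t) a.
  by split; [apply: agreeW av|apply: agreeW aa]; lia.
rewrite /pair_level /= !orbF -!/(pair_level _ _ _ _ _ _) IHt; first last.
- by apply: agreeW aa; lia.
- by apply: agreeW av; lia.
by rewrite !transfer_pair_tight.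
Qed.

Lemma transfer_paired v : agree (3 + 2 * L) v ->
  paired q k M L nb' (f v) = paired q k M L nb v.
Proof. exact: transfer_pair_tight (@transfer_pair_level L). Qed.

Lemma transfer_open2 v : agree (4 + 2 * L) v ->
  open2 q k M L nb' (f v) = open2 q k M L nb v.
Proof.
move=> av; congr (~~ _); apply: transfer_covers av => u au.
by rewrite transfer_hard ?transfer_paired //; apply: agreeW au; lia.
Qed.

Lemma transfer_star r v : agree r v -> star nb' (f v) = [seq f u | u <- star nb v].
Proof. by move=> /agree_nb; rewrite /star /= => ->. Qed.

Lemma agree_star r v u : agree r.+1 v -> u \in star nb v -> agree r u.
Proof.
by move=> av; rewrite inE => /predU1P[->|/(agree_step av)//]; apply: agreeW av.
Qed.

(** Determining [open2] takes radius [4 + 2 * L]; each step then adds one edge from an element to a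
    set and one from a set to its elements. *)
Lemma transfer_star_tight t v :
    (forall u, agree (4 + 2 * L + 2 * t) u ->
      star_level q k M L nb' t (f u) = star_level q k M L nb t u) ->
    agree (5 + 2 * L + 2 * t) v ->
  tight q (scale q) L (star_elems q k M L nb') (star_level q k M L nb' t) (f v) =
  tight q (scale q) L (star_elems q k M L nb) (star_level q k M L nb t) v.
Proof.
move=> lev av; congr (_ <= _)%R; rewrite /load /star_elems (transfer_star av) filter_map big_map.
rewrite !big_filter big_seq_cond [RHS]big_seq_cond; apply: eq_big => u /=.
  case vu: (u \in star nb v) => //=; apply: transfer_open2.
  by apply: agreeW (agree_star (r := 4 + 2 * L + 2 * t) av vu); lia.
by case/andP=> vu _; rewrite /value lev //; apply: agree_star vu.
Qed.

Lemma transfer_star_level t u : agree (4 + 2 * L + 2 * t) u ->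
  star_level q k M L nb' t (f u) = star_level q k M L nb t u.
Proof.
elim: t u => // t IHt u au.
rewrite /star_level !level_succ -!/(star_level _ _ _ _ _ _) IHt; last first.
  by apply: agreeW au; rewrite leq_add2l leq_mul2l leqnSn.
rewrite (transfer_star au) has_map; congr (_ + ~~ _); apply: eq_in_has => v uv /=.
by apply: transfer_star_tight => //; apply: agree_star uv; apply: agreeW au; lia.
Qed.

Lemma transfer_central v : agree (5 + 2 * L + 2 * L) v ->
  central q k M L nb' (f v) = central q k M L nb v.
Proof. exact: transfer_star_tight (@transfer_star_level L). Qed.

Lemma transfer_selected v : agree (6 + 4 * L) v ->
  selected q k M L nb' (f v) = selected q k M L nb v.
Proof.
move=> av; have aw r : r <= 6 + 4 * L -> agree r v by move/agreeW; apply.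
rewrite /selected transfer_hard ?transfer_paired ?transfer_central ?transfer_open2;
  try by apply: aw; lia.
rewrite (transfer_covers (r := 5 + 2 * L + 2 * L) (S := central q k M L nb)) //.
  exact: transfer_central.
by apply: aw; lia.
Qed.
End Locality.

(** * Collecting a ball by message passing *)

Section Gathering.
Local Open Scope nat_scope.

(* The identifier of the vertex, and the neighbor lists that it has learned. *)
Definition knowledge : Type := nat * seq (nat * seq nat).

Definition lookup (kn : seq (nat * seq nat)) i := nth [::] (unzip2 kn) (index i (unzip1 kn)).

Definition learn (s : knowledge) (ms : seq (option knowledge)) : knowledge :=
  let known := pmap id ms in
  (s.1, (s.1, unzip1 known) :: s.2 ++ flatten (unzip2 known)).

Definition gather (f : (nat -> seq nat) -> nat -> bool) : local_algorithm :=
  @LocalAlgorithm knowledge knowledge (fun i => (i, [::])) (fun s _ => Some s) learn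
    (fun s => f (lookup s.2) s.1).

Variables (f : (nat -> seq nat) -> nat -> bool) (V : finType).
Variables (port : V -> seq V) (ident : V -> nat).
Hypothesis ident_inj : injective ident.

Local Notation kn t v := (@run (gather f) V port ident t v).

Lemma gather_round t v :
  kn t.+1 v = ((kn t v).1, ((kn t v).1, [seq (kn t u).1 | u <- port v]) ::
    (kn t v).2 ++ flatten [seq (kn t u).2 | u <- port v]).
Proof.
rewrite /run iterS -/(run _ _ _ _) /round /inbox /= /learn.
have -> : pmap id [seq Some (kn t u) | u <- port v] = [seq kn t u | u <- port v].
  by elim: (port v) => //= u s ->.
by rewrite /unzip1 /unzip2 -!map_comp.
Qed.

Lemma gather_id t v : (kn t v).1 = ident v.
Proof. by elim: t => // t IHt; rewrite gather_round. Qed.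

Lemma gather_sound t v e : e \in (kn t v).2 ->
  exists w, e = (ident w, [seq ident u | u <- port w]).
Proof.
elim: t v => // t IHt v; rewrite gather_round /= inE mem_cat => /or3P[/eqP->|/IHt//|].
  exists v; rewrite gather_id; congr (_, _); apply: eq_map => u; exact: gather_id.
by case/flattenP=> _ /mapP[u _ ->] /IHt.
Qed.

Fixpoint known (kn : seq (nat * seq nat)) r v : Prop := ident v \in unzip1 kn /\
  if r is r'.+1 then forall u, u \in port v -> known kn r' u else True.

Lemma known_sub kn1 kn2 r v : {subset kn1 <= kn2} -> known kn1 r v -> known kn2 r v.
Proof.
move=> sub; have sub1 : {subset unzip1 kn1 <= unzip1 kn2}.
  by move=> _ /mapP[e /sub e2 ->]; apply: map_f.
elim: r v => [|r IHr] v [kv kr]; split=> //; try exact: sub1.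
by move=> u /kr; apply: IHr.
Qed.

(** Radius [r] takes [r + 1] rounds, because a vertex learns the identifiers of its own neighbors
    only in the first round. *)
Lemma gather_known r w : known (kn r.+1 w).2 r w.
Proof.
have own t v : ident v \in unzip1 (kn t.+1 v).2 by rewrite gather_round /= gather_id mem_head.
elim: r w => [|r IHr] v; split=> //.
move=> u uv; apply: known_sub (IHr u) => e eu.
rewrite gather_round inE mem_cat; apply/or3P; apply: Or33.
by apply/flattenP; exists (kn r.+1 u).2 => //; apply/mapP; exists u.
Qed.

(** All entries for one identifier agree, since they are true neighbor lists and identifiers are
    distinct; looking up the first one is thus correct. *)
Lemma gather_agree r v : agree port (lookup (kn r.+1 v).2) ident r v.
Proof.
have look w : ident w \in unzip1 (kn r.+1 v).2 ->
    lookup (kn r.+1 v).2 (ident w) = [seq ident u | u <- port w].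
  move=> ww; have /mapP[e ek we] := ww; rewrite /lookup.
  set i := index _ _; have i_lt : i < size (kn r.+1 v).2 by rewrite -(size_map fst) index_mem.
  rewrite (nth_map e) //; have [w' def_e] := gather_sound (mem_nth e i_lt).
  have : nth 0 (unzip1 (kn r.+1 v).2) i = ident w by apply: nth_index.
  by rewrite (nth_map e) // def_e /= => /ident_inj ->.
move: (gather_known r v) look; move: (kn r.+1 v).2 => k.
elim: r v => [|r IHr] v [kv kr] look; split=> //; try exact: look.
by move=> u uv; apply: IHr => //; apply: kr.
Qed.

End Gathering.

(** * Growth estimates and choice of the constants *)

Section Numbers.
Variables (R : realType).

Lemma bernoulli (x : R) n : 0 <= x -> 1 + n%:R * x <= (1 + x) ^+ n.
Proof.
move=> x0; elim: n => [|n IHn]; first by rewrite mul0r addr0.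
rewrite exprS; apply: le_trans (ler_wpM2l _ IHn); last lra.
have n0 : 0 <= n%:R :> R by [].
by rewrite -natr1; nra.
Qed.

Lemma natr_ge (x : R) : exists n : nat, x <= n%:R.
Proof.
exists (Num.bound `|x|); apply: le_trans (ler_norm x) (ltW _).
exact/archi_boundP/normr_ge0.
Qed.

Lemma expr_unbounded (q x : R) : 1 < q -> exists n, x <= q ^+ n.
Proof.
move=> q1; have [n xn] := natr_ge (x / (q - 1)); exists n.
have := @bernoulli (q - 1) n; rewrite subrKC => h; apply: le_trans (h _); last lra.
by rewrite ler_pdivrMr in xn; lra.
Qed.
End Numbers.

Theorem theorem1p1 (R : realType) (eps : R) (eps_gt0 : 0 < eps) :
  exists (A : local_algorithm) (T : nat),
  forall (V : finType) (E : rel V),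
    symmetric E -> irreflexive E -> planar R E ->
  forall (ident : V -> nat) (port : V -> seq V),
    injective ident -> port_numbering E port ->
    dominating E (local_output A port ident T) /\
    #|local_output A port ident T|%:R
      <= (8 + eps) * (domination_number E)%:R :> R.
Proof.
(* As [eta <= 1], [8 * q * q = 8 + 16 * eta + 8 * eta ^ 2] is at most [8 + 24 * eta], hence at most
   [8 + eps]. *)
pose eta := Num.min 1 (eps / 24).
have eta_gt0 : 0 < eta by rewrite lt_min ltr01 divr_gt0.
have [eta1 eta_eps] : eta <= 1 /\ eta <= eps / 24 by rewrite !ge_min !lexx orbT.
pose q := 1 + eta; have q_gt1 : 1 < q by rewrite ltrDl.
(* [k] keeps the exceptions below an [eta] fraction of the dominating set, and [L] makes the initial
   loads at most 1. *)
have [k k_big] := natr_ge (6 / eta + 5).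
have [L L_big] := expr_unbounded (k * (3 * k).+1 + 1)%N%:R q_gt1.
have kq : 6 <= (q - 1) * (k%:R - 5).
  have -> : q - 1 = eta by rewrite /q addrC addKr.
  have -> : 6 = eta * (6 / eta + 5 - 5) :> R by field; rewrite gt_eqF.
  by rewrite ler_pM2l // lerD2r.
(* [selected] depends on the ball of radius [6 + 4 * L], which takes one more round to collect. *)
exists (gather (fun nb => selected q k (3 * k).+1 L nb)), (6 + 4 * L).+1%N.
move=> V E symE irrE planarE ident port ident_inj portP.
have out : local_output (gather (fun nb => selected q k (3 * k).+1 L nb))
    port ident (6 + 4 * L).+1 = [set v | selected q k (3 * k).+1 L port v].
  apply/setP => v; rewrite !inE.
  pose f nb := selected q k (3 * k).+1 L nb : nat -> bool.
  rewrite -(transfer_selected q k (3 * k).+1 ident_inj (gather_agree f port ident_inj _ v)).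
  by rewrite -(gather_id f port ident (6 + 4 * L).+1 v).
rewrite out; have noK33 := planar_no_K33 planarE.
have arcsP (A : {set V}) (F : rel V) b : minor_model E A F b -> symmetric F -> irreflexive F ->
    (#|arcs A F| <= 6 * #|A|)%N.
  move=> model symF irrF; have [->|A0] := eqVneq A set0.
    by rewrite cards0 (_ : arcs _ _ = set0) ?cards0 //; apply/setP => p; rewrite !inE.
  apply: leq_trans (arcs_bound symE _ model symF irrF A0); first exact: leq_addr.
  by move=> A' F' b' s; apply: (planar_no_K5 planarE).
split; first exact: selected_dominating.
rewrite /domination_number; case: arg_minnP => [|D domD _].
  by apply/forallP => v; rewrite inE.
apply: le_trans (selected_bound symE irrE portP arcsP noK33 q_gt1 L_big kq domD) _.
by rewrite ler_wpM2r //; rewrite /q; nra.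
Qed.
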